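(* The decision problem \textsc{Optimal Transfers} is in P for two agents with identical utilities (i.e., when restricted to instances with $n=2$ agents and $u_1=u_2$).
   Context: Let $N=\{1,\dots,n\}$ be a set of $n\ge 2$ agents and $M$ a set of $m\ge 1$ indivisible goods. Each agent $i$ has an additive utility function $u_i:2^M\to\mathbb{R}_{\ge 0}$, i.e., $u_i(M')=\sum_{g\in M'}u_i(\{g\})$ for all $M'\subseteq M$. An instance consists of $N$, $M$ and $(u_i)_{i\in N}$. Utilities are identical if $u_i=u_j$ for all $i,j\in N$. An allocation $\mathcal{A}=(A_1,\dots,A_n)$ is an ordered partition of $M$ into $n$ (possibly empty) bundles, with $A_i$ allocated to agent $i$. Agent $i$ is EF1 towards agent $j$ in $\mathcal{A}$ if $A_j=\varnothing$ or there exists $g\in A_j$ with $u_i(A_i)\ge u_i(A_j\setminus\{g\})$. $\mathcal{A}$ is EF1 if every agent is EF1 towards every other agent. A transfer moves a single good from one agent's bundle to another agent's bundle, leaving everything else unchanged. The optimal number of transfers required to reach an EF1 allocation from $\mathcal{A}$ is the smallest $T\ge 0$ such that some sequence of $T$ transfers starting at $\mathcal{A}$ ends in an EF1 allocation. \textsc{Optimal Transfers}: given an instance, an initial allocation $\mathcal{A}$ in the instance, and a number $k$, decide whether the optimal number of transfers required to reach an EF1 allocation from $\mathcal{A}$ is at most $k$. *)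

(* Defs.v *)
From HB Require Import structures.
From mathcomp Require Import all_boot all_order all_algebra.
Set Implicit Arguments.
Unset Strict Implicit.
Unset Printing Implicit Defensive.
Import GRing.Theory Num.Theory.

(** * Fair division *)

Record instance (R : numDomainType) := Instance {
  agents : nat;
  goods : nat;
  utility : 'I_agents -> {set 'I_goods} -> R;
  agents_ge2 : 1 < agents;
  goods_ge1 : 0 < goods;
  utility_ge0 : forall i S, (0 <= utility i S)%R;
  utility_additive : forall i S,
    utility i S = (\sum_(g in S) utility i [set g])%R }.

(* An ordered partition of the goods into possibly empty bundles, given by the
   owner of each good. *)
Definition allocation R (I : instance R) := {ffun 'I_(goods I) -> 'I_(agents I)}.

Section FairDivision.
Variables (R : numDomainType) (I : instance R).
Implicit Types (A B : allocation I) (i j : 'I_(agents I)).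

Definition identical_utilities := forall i j, utility i =1 utility j.

Definition bundle A i : {set 'I_(goods I)} := [set g | A g == i].

Definition EF1_towards A i j :=
  bundle A j = set0 \/
  exists2 g, g \in bundle A j &
    (utility i (bundle A j :\ g) <= utility i (bundle A i))%R.

Definition EF1 A := forall i j, i != j -> EF1_towards A i j.

Definition transfer : rel (allocation I) := fun A B =>
  [exists g, (A g != B g) && [forall h, (h != g) ==> (A h == B h)]].

Definition EF1_after A T := exists s : seq (allocation I),
  [/\ size s = T, path transfer A s & EF1 (last A s)].

Definition optimal_transfer_count A T :=
  EF1_after A T /\ forall T', EF1_after A T' -> T <= T'.

End FairDivision.

(** * Deterministic multitape Turing machines *)

Inductive direction := MoveLeft | Stay | MoveRight.

(* The tape alphabet consists of the input alphabet, the machine's own work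
   symbols and the blank symbol [None]; tape [ord0] is the input tape.
   [verdict q] is [None] when [q] is not a halting state, and otherwise tells
   whether [q] accepts. *)
Record machine (Sigma : finType) := Machine {
  extra_tapes : nat;
  work_symbol : finType;
  state : finType;
  start : state;
  verdict : state -> option bool;
  transition : state ->
    {ffun 'I_extra_tapes.+1 -> option (Sigma + work_symbol)} ->
    state * ('I_extra_tapes.+1 ->
               option (Sigma + work_symbol) * direction) }.

Section Machine.
Variables (Sigma : finType) (M : machine Sigma).

Definition tape_symbol : Type := option (Sigma + work_symbol M).

(* [(l, r)] is the two-way infinite tape ... l_1 l_0 r_0 r_1 ..., blank beyond
   both lists, with the head on r_0. *)
Definition tape : Type := seq tape_symbol * seq tape_symbol.

Definition scanned (t : tape) : tape_symbol := head None t.2.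

Definition write_move (t : tape) (a : tape_symbol * direction) : tape :=
  let: (l, r) := t in
  let: (x, d) := a in
  match d with
  | MoveLeft => (behead l, head None l :: x :: behead r)
  | Stay => (l, x :: behead r)
  | MoveRight => (x :: l, behead r)
  end.

Definition config : Type := state M * {ffun 'I_(extra_tapes M).+1 -> tape}.

Definition init (w : seq Sigma) : config :=
  (start M,
   [ffun i => ([::], if i == ord0 then [seq Some (inl x) | x <- w] else [::])]).

Definition step (c : config) : config :=
  let: (q, ts) := c in
  if verdict q is Some _ then c else
  let: (q', act) := transition q [ffun i => scanned (ts i)] in
  (q', [ffun i => write_move (ts i) (act i)]).

Definition decides_in_time (L : seq Sigma -> Prop) (time : nat -> nat) :=
  forall w, exists t b,
    [/\ t <= time (size w),
        verdict (iter t step (init w)).1 = Some b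
      & b <-> L w].

End Machine.

Definition in_P (Sigma : finType) (L : seq Sigma -> Prop) :=
  exists (M : machine Sigma) (p : {poly nat}),
    decides_in_time M L (fun n => p.[n])%R.

(** * Optimal Transfers as a formal language *)

(* Binary digits, least significant first, without superfluous zeros:
   [up_log 2 a.+1] is the bit length of [a], and [binary 0 = [::]]. *)
Definition binary (a : nat) : seq bool :=
  [seq odd (a %/ 2 ^ e) | e <- iota 0 (up_log 2 a.+1)].

(* Each number is terminated by the separator [None]. *)
Definition encode_nats (s : seq nat) : seq (option bool) :=
  flatten [seq rcons [seq Some b | b <- binary a] None | a <- s].

(* By additivity it suffices to list the utilities of single goods, which are
   given as fractions, not necessarily in lowest terms. *)
Definition encodes (w : seq (option bool))
    (I : instance rat) (A : allocation I) (k : nat) :=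
  exists num den : 'I_(agents I) -> 'I_(goods I) -> nat,
  [/\ forall i g, 0 < den i g,
      forall i g, utility i [set g] = ((num i g)%:R / (den i g)%:R)%R
    & w = encode_nats
        ([:: agents I; goods I]
         ++ flatten [seq [:: num i g; den i g]
                    | i <- enum 'I_(agents I), g <- enum 'I_(goods I)]
         ++ [seq val (A g) | g <- enum 'I_(goods I)]
         ++ [:: k])].

(* The problem restricted to the instances in [C]: the language of the encodings
   of its yes-instances. *)
Definition OptimalTransfers (C : instance rat -> Prop)
    (w : seq (option bool)) :=
  exists (I : instance rat) (A : allocation I) (k : nat),
    [/\ C I, encodes w A k & exists2 T, optimal_transfer_count A T & T <= k].

(* Main.v *)
Require Import Defs.
From Stdlib Require Import FunctionalExtensionality.
From mathcomp Require Import all_boot all_order all_algebra zify lra.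
Set Implicit Arguments.
Unset Strict Implicit.
Unset Printing Implicit Defensive.
Import Order.TTheory GRing.Theory Num.Theory.

(** Fix an allocation, call the two bundles poor and rich according to their
    utility, and let [s_j] be the total utility of the [j] most valuable goods of
    the rich bundle.  Handing over these goods in decreasing order of utility is
    optimal: an EF1 allocation can be reached with at most [k] transfers iff
    [u(rich) <= u(poor) + s_k + s_(k+1)].  At the first [k] satisfying this
    inequality the poor agent is EF1 towards the rich one, and its failure at
    [k - 1] makes the rich agent EF1 towards the poor one; conversely [k]
    transfers move goods worth at most [s_k] out of the rich bundle, and removing
    one more good raises this to [s_(k+1)].  The inequality is tested by sorting
    and exact arithmetic on fractions.

    For the running time, structured programs over five stacks are compiled to
    Turing machines, and data are binary trees kept on a stack in Polish notation.
    The functions computable in polynomial time in this sense are closed under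
    composition, pairing, branching, and folds all of whose intermediate results
    have polynomial size. *)

(** * Stack programs and their compilation to Turing machines *)

(** Since fractions need not be in lowest terms, identity of the utilities is tested by cross
    multiplication. The bound [k] is written in binary and may be exponential in the length of the
    word, so nothing may be repeated [k] times; prefixes of length [k] are cut out by comparing
    positions with [k]. The optimum itself is never computed: the inequality is monotone in [k], so
    testing it at the given bound suffices. A fold is admissible only if its accumulator stays small
    on every prefix of the list. This is where the size estimates come from; sums of unreduced
    fractions pass because adding fractions only adds up bit lengths. *)

Definition symb : Type := (option bool + bool)%type.

(* Input, data, two temporary stacks, and a counter. *)
Inductive reg := InT | DtT | RtT | StT | CtT.

Record store := Store {
  inS : seq symb; dtS : seq symb; rtS : seq symb; stS : seq symb; ctS : seq symb }.

Definition get (i : reg) (s : store) : seq symb :=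
  match i with
  | InT => inS s | DtT => dtS s | RtT => rtS s | StT => stS s | CtT => ctS s
  end.

Definition set (i : reg) (x : seq symb) (s : store) : store :=
  let: Store a b c d e := s in
  match i with
  | InT => Store x b c d e
  | DtT => Store a x c d e
  | RtT => Store a b x d e
  | StT => Store a b c x e
  | CtT => Store a b c d x
  end.

Inductive prog :=
| Push (i : reg) (a : symb)
| Pop (i : reg)
| Seq (p q : prog)
| If (i : reg) (b : option symb -> bool) (p q : prog)
| While (i : reg) (b : option symb -> bool) (p : prog).

(** The costs are the step counts of the compiled machine: a push moves to the cell above the stack
    and then writes, a pop erases and moves in a single step, and a test takes a step of its own. *)
Inductive run : prog -> store -> nat -> store -> Prop :=
| run_push i a s : run (Push i a) s 2 (set i (a :: get i s) s)
| run_pop i s : run (Pop i) s 1 (set i (behead (get i s)) s)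
| run_seq p q s t s1 u s2 :
    run p s t s1 -> run q s1 u s2 -> run (Seq p q) s (t + u) s2
| run_if_true i (b : option symb -> bool) p q s t s1 :
    b (ohead (get i s)) -> run p s t s1 -> run (If i b p q) s t.+1 s1
| run_if_false i (b : option symb -> bool) p q s t s1 :
    ~~ b (ohead (get i s)) -> run q s t s1 -> run (If i b p q) s t.+1 s1
| run_while_stop i (b : option symb -> bool) p s :
    ~~ b (ohead (get i s)) -> run (While i b p) s 1 s
| run_while_step i (b : option symb -> bool) p s t s1 u s2 :
    b (ohead (get i s)) -> run p s t s1 -> run (While i b p) s1 u s2 ->
    run (While i b p) s (t + u).+1 s2.

(** The [None] of the [option] types is the state that performs the test; the boolean of a push
    tells whether the head has already moved. *)
Fixpoint control (p : prog) : finType :=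
  match p with
  | Push _ _ => bool
  | Pop _ => unit
  | Seq p q => (control p + control q)%type
  | If _ _ p q => option (control p + control q)
  | While _ _ p => option (control p)
  end.

Fixpoint entry (p : prog) : control p :=
  match p return control p with
  | Push _ _ => false
  | Pop _ => tt
  | Seq p _ => inl (entry p)
  | If _ _ _ _ => None
  | While _ _ _ => None
  end.

Definition act : Type := option (reg * (option symb * direction)).

(** Successor [None] means that the program has ended. A sequence enters its second part in the very
    step that ends the first, so [run] adds the two costs without overhead. *)
Fixpoint delta (p : prog) : control p -> (reg -> option symb) ->
    option (control p) * act :=
  match p return control p -> (reg -> option symb) -> option (control p) * act with
  | Push i a => fun c rd =>
      if c then (None, Some (i, (Some a, Stay)))
      else (Some true, Some (i, (rd i, MoveLeft)))
  | Pop i => fun _ _ => (None, Some (i, (None, MoveRight)))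
  | Seq p q => fun c rd =>
      match c with
      | inl c1 => let: (n, a) := delta c1 rd in
                  (Some (if n is Some c2 then inl c2 else inr (entry q)), a)
      | inr c1 => let: (n, a) := delta c1 rd in (omap inr n, a)
      end
  | If i b p q => fun c rd =>
      match c with
      | None => (Some (Some (if b (rd i) then inl (entry p) else inr (entry q))),
                 None)
      | Some (inl c1) => let: (n, a) := delta c1 rd in
                         (omap (fun c2 => Some (inl c2)) n, a)
      | Some (inr c1) => let: (n, a) := delta c1 rd in
                         (omap (fun c2 => Some (inr c2)) n, a)
      end
  | While i b p => fun c rd =>
      match c with
      | None => (if b (rd i) then Some (Some (entry p)) else None, None)
      | Some c1 => let: (n, a) := delta c1 rd in (Some n, a)
      end
  end.

Definition ord_of_reg (i : reg) : 'I_5 :=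
  match i with
  | InT => @Ordinal 5 0 isT | DtT => @Ordinal 5 1 isT | RtT => @Ordinal 5 2 isT
  | StT => @Ordinal 5 3 isT | CtT => @Ordinal 5 4 isT
  end.

Lemma ord_of_reg_inj : injective ord_of_reg.
Proof. by case; case. Qed.

Definition act_at (a : act) (rd : 'I_5 -> option symb) (o : 'I_5) :
    option symb * direction :=
  if a is Some (i, x) then if ord_of_reg i == o then x else (rd o, Stay)
  else (rd o, Stay).

(** The answer is read off the top of the data stack, because the code of the tree for [true] starts
    with [one] and that for [false] with [zero]. This takes one step after the program has ended. *)
Definition compile (p : prog) : machine (option bool) :=
  @Machine (option bool) 4 bool (option (control p) + bool)%type
    (inl (Some (entry p)))
    (fun q => if q is inr b then Some b else None)
    (fun q rd =>
      match q with
      | inl (Some c) =>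
          let: (n, a) := delta c (fun i => rd (ord_of_reg i)) in
          (inl n, act_at a rd)
      | inl None => (inr (rd (ord_of_reg DtT) == Some (inr true)), act_at None rd)
      | inr b => (inr b, act_at None rd)
      end).

Definition mtape : Type := (seq (option symb) * seq (option symb))%type.

(* Cells beyond the stack may hold explicit blanks, so lists are compared up to
   trailing [None]s. *)
Definition tape_of_stack (t : mtape) (s : seq symb) :=
  (forall n, nth None t.1 n = None) /\
  (forall n, nth None t.2 n = nth None [seq Some x | x <- s] n).

Definition tapes_of_store (ts : {ffun 'I_5 -> mtape}) (s : store) :=
  forall i, tape_of_stack (ts (ord_of_reg i)) (get i s).

(** * Step-by-step simulation of a stack program by its machine *)

Section Simulation.
Variable p0 : prog.
Let M := compile p0.

Definition wm (t : mtape) (a : option symb * direction) : mtape :=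
  @write_move _ M t a.

Definition scan_tape (t : mtape) : option symb := head None t.2.

Definition apply_act (a : act) (ts : {ffun 'I_5 -> mtape}) : {ffun 'I_5 -> mtape} :=
  [ffun o => wm (ts o) (act_at a [ffun o => scan_tape (ts o)] o)].

Definition reading (ts : {ffun 'I_5 -> mtape}) (i : reg) : option symb :=
  scan_tape (ts (ord_of_reg i)).

(** Defined for every program and not just for [p0], so that subprograms can be treated by
    induction; all compiled machines share one tape alphabet. *)
Inductive reach (p : prog) : control p -> {ffun 'I_5 -> mtape} -> nat ->
    {ffun 'I_5 -> mtape} -> Prop :=
| reach_done c ts a : delta c (reading ts) = (None, a) ->
    reach c ts 1 (apply_act a ts)
| reach_more c ts c' a t ts' : delta c (reading ts) = (Some c', a) ->
    reach c' (apply_act a ts) t ts' -> reach c ts t.+1 ts'.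

Lemma reach_seqr p q (c : control q) ts t ts1 :
  reach c ts t ts1 -> @reach (Seq p q) (inr c) ts t ts1.
Proof.
elim=> {c ts t ts1} [c ts a E|c ts c' a t ts' E _ IH].
  by apply: reach_done; rewrite /= E.
by apply: reach_more IH; rewrite /= E.
Qed.

Lemma reach_seq p q (c : control p) ts t ts1 u ts2 :
  reach c ts t ts1 -> reach (entry q) ts1 u ts2 ->
  @reach (Seq p q) (inl c) ts (t + u) ts2.
Proof.
elim=> {c ts t ts1} [c ts a E|c ts c' a t ts' E _ IH] Rq.
  by apply: reach_more (reach_seqr _ Rq); rewrite /= E.
by rewrite addSn; apply: reach_more (IH Rq); rewrite /= E.
Qed.

Lemma reach_ifl i b p q (c : control p) ts t ts1 :
  reach c ts t ts1 -> @reach (If i b p q) (Some (inl c)) ts t ts1.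
Proof.
elim=> {c ts t ts1} [c ts a E|c ts c' a t ts' E _ IH].
  by apply: reach_done; rewrite /= E.
by apply: reach_more IH; rewrite /= E.
Qed.

Lemma reach_ifr i b p q (c : control q) ts t ts1 :
  reach c ts t ts1 -> @reach (If i b p q) (Some (inr c)) ts t ts1.
Proof.
elim=> {c ts t ts1} [c ts a E|c ts c' a t ts' E _ IH].
  by apply: reach_done; rewrite /= E.
by apply: reach_more IH; rewrite /= E.
Qed.

Lemma reach_while i b p (c : control p) ts t ts1 u ts2 :
  reach c ts t ts1 -> @reach (While i b p) None ts1 u ts2 ->
  @reach (While i b p) (Some c) ts (t + u) ts2.
Proof.
elim=> {c ts t ts1} [c ts a E|c ts c' a t ts' E _ IH] R.
  by apply: reach_more R; rewrite /= E.
by rewrite addSn; apply: reach_more (IH R); rewrite /= E.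
Qed.

Lemma scan_tapeE t s : tape_of_stack t s -> scan_tape t = ohead s.
Proof. by case=> _ /(_ 0); rewrite /scan_tape -!nth0 => ->; case: s. Qed.

Lemma readingE ts s i : tapes_of_store ts s -> reading ts i = ohead (get i s).
Proof. by move=> /(_ i); exact: scan_tapeE. Qed.

Lemma wm_stay t s : tape_of_stack t s -> tape_of_stack (wm t (scan_tape t, Stay)) s.
Proof.
case: t => l r [/= Hl Hr]; split=> //= n.
by rewrite -Hr; case: n r {Hr} => [|n] [|x r] //=; rewrite nth_nil.
Qed.

Lemma apply_actE ts s i x d u : tapes_of_store ts s ->
  (tape_of_stack (wm (ts (ord_of_reg i)) (x, d)) u) ->
  tapes_of_store (apply_act (Some (i, (x, d))) ts) (set i u s).
Proof.
move=> Hs Hi j; rewrite /apply_act ffunE /act_at.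
case: eqP => [/ord_of_reg_inj <-|ne].
  by have -> : get i (set i u s) = u by case: (i) s {Hs Hi} => -[].
have -> : get j (set i u s) = get j s.
  by case: s {Hs Hi} => a b c e f; case: i j ne => -[].
by rewrite ffunE; apply: wm_stay.
Qed.

Lemma apply_act0 ts s : tapes_of_store ts s -> tapes_of_store (apply_act None ts) s.
Proof. by move=> Hs i; rewrite /apply_act ffunE /act_at ffunE; apply: wm_stay. Qed.

Lemma get_set i u s : get i (set i u s) = u.
Proof. by case: s; case: i. Qed.

(** The tapes are arbitrary representatives of the store: a pop leaves an explicit blank behind the
    head, so the store does not determine the tapes. *)
Lemma run_reach p s t s' : run p s t s' -> forall ts, tapes_of_store ts s ->
  exists2 ts', tapes_of_store ts' s' & reach (entry p) ts t ts'.
Proof.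
elim=> {p s t s'}.
- move=> i a s ts Hs.
  (* The intermediate configuration scans the blank on top of the stack, which
     is no stack, so both steps are treated together. *)
  set ts1 := apply_act (Some (i, (reading ts i, MoveLeft))) ts.
  exists (apply_act (Some (i, (Some a, Stay))) ts1); last first.
    by apply: (@reach_more (Push i a) false ts true (Some (i, (reading ts i, MoveLeft)))) => //;
       apply: reach_done.
  move=> j; rewrite /apply_act ffunE /act_at.
  case: eqP => [/ord_of_reg_inj <-|ne].
    rewrite get_set /ts1 /apply_act ffunE /act_at eqxx.
    have [] := Hs i; rewrite /reading /scan_tape.
    case: (ts (ord_of_reg i)) => l r /= Hl Hr; split=> /= n.
      by rewrite nth_behead Hl.
    case: n => //= n; rewrite -Hr.
    by case: n r {Hr} => [|n] [|x r] //=; rewrite nth_nil.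
  have -> : get j (set i (a :: get i s) s) = get j s.
    by case: s {ts1 Hs} => b c d e f; case: i j ne => -[].
  rewrite ffunE; apply: wm_stay.
  rewrite /ts1 /apply_act ffunE /act_at; case: eqP => // _.
  by rewrite ffunE; apply: wm_stay.
- move=> i s ts Hs.
  exists (apply_act (Some (i, (None, MoveRight))) ts); last exact: reach_done.
  apply: apply_actE => //.
  have [] := Hs i; case: (ts (ord_of_reg i)) => l r /= Hl Hr; split=> /= n.
    by case: n.
  by rewrite nth_behead Hr; case: (get i s) => //=; rewrite nth_nil.
- move=> p q s t s1 u s2 _ IHp _ IHq ts /IHp[ts1 /IHq[ts2 H2 R2] R1].
  by exists ts2 => //; apply: reach_seq R1 R2.
- move=> i b p q s t s1 Hb _ IH ts Hs.
  have [ts1 H1 R1] := IH _ (apply_act0 Hs); exists ts1 => //.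
  by apply: reach_more (reach_ifl _ _ _ R1); rewrite /= (readingE _ Hs) Hb.
- move=> i b p q s t s1 Hb _ IH ts Hs.
  have [ts1 H1 R1] := IH _ (apply_act0 Hs); exists ts1 => //.
  by apply: reach_more (reach_ifr _ _ _ R1); rewrite /= (readingE _ Hs) (negPf Hb).
- move=> i b p s Hb ts Hs.
  exists (apply_act None ts); first exact: apply_act0.
  by apply: reach_done; rewrite /= (readingE _ Hs) (negPf Hb).
- move=> i b p s t s1 u s2 Hb _ IHp _ IHw ts Hs.
  have [ts1 H1 R1] := IHp _ (apply_act0 Hs).
  have [ts2 H2 R2] := IHw _ H1; exists ts2 => //.
  by apply: reach_more (reach_while R1 R2); rewrite /= (readingE _ Hs) Hb.
Qed.

Lemma reach_iter (c : control p0) ts t ts' : reach c ts t ts' ->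
  iter t (@step _ M) (inl (Some c), ts) = (inl None, ts').
Proof.
have stepE c1 ts1 : @step _ M (inl (Some c1), ts1) =
    (inl (delta c1 (reading ts1)).1, apply_act (delta c1 (reading ts1)).2 ts1).
  rewrite /step /=.
  have -> : delta c1 (fun i => [ffun i0 => @scanned _ M (ts1 i0)] (ord_of_reg i))
    = delta c1 (reading ts1).
    congr delta; apply: functional_extensionality => i; by rewrite ffunE.
  by case: (delta _ _).
elim=> {c ts t ts'} [c ts a E|c ts c' a t ts' E _ IH].
  by rewrite /iter stepE E.
by rewrite iterSr stepE E.
Qed.

End Simulation.

Lemma decides_compile p (L : seq (option bool) -> Prop) (time : nat -> nat) :
  (forall w, exists t s, [/\ t <= time (size w),
     run p (Store [seq inl x | x <- w] [::] [::] [::] [::]) t s &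
     (ohead (dtS s) == Some (inr true)) <-> L w]) ->
  decides_in_time (compile p) L (fun n => (time n).+1).
Proof.
move=> H w; have [t [s [le_t R HL]]] := H w.
have [|ts' H' R'] := run_reach p R (ts := (init (compile p) w).2).
  move=> i; rewrite ffunE; split=> [n|]; first by rewrite nth_nil.
  by case: i => //= n; rewrite -map_comp.
exists t.+1, (ohead (dtS s) == Some (inr true)); split=> //.
have -> : init (compile p) w = (inl (Some (entry p)), (init (compile p) w).2) by [].
rewrite iterS (reach_iter R') /= ffunE.
by rewrite [X in X == _](scan_tapeE (H' DtT)).
Qed.

(** * Binary trees on stacks *)

(** Natural coefficients make these functions monotone, so a time bound may be evaluated at any
    upper bound for the size of the argument. *)
Inductive polyfun : (nat -> nat) -> Prop :=
| polyfun_const c : polyfun (fun _ => c)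
| polyfun_id : polyfun id
| polyfun_add f g : polyfun f -> polyfun g -> polyfun (fun n => f n + g n)
| polyfun_mul f g : polyfun f -> polyfun g -> polyfun (fun n => f n * g n).

Lemma polyfun_comp f g : polyfun f -> polyfun g -> polyfun (fun n => f (g n)).
Proof.
move=> Hf Hg; elim: Hf => // [c|f1 f2 _ IH1 _ IH2|f1 f2 _ IH1 _ IH2].
- exact: polyfun_const.
- exact: polyfun_add.
- exact: polyfun_mul.
Qed.

Lemma polyfun_mono f m n : polyfun f -> m <= n -> f m <= f n.
Proof.
move=> Hf le_mn; elim: Hf => // f1 f2 _ IH1 _ IH2; first exact: leq_add.
exact: leq_mul.
Qed.

Lemma polyfun_poly f : polyfun f -> exists p : {poly nat}, forall n, f n = (p.[n])%R.
Proof.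
elim=> [c||f1 f2 _ [p1 E1] _ [p2 E2]|f1 f2 _ [p1 E1] _ [p2 E2]].
- by exists (polyC c) => n; rewrite hornerC.
- by exists 'X%R => n; rewrite hornerX.
- by exists (p1 + p2)%R => n; rewrite hornerD E1 E2.
- by exists (p1 * p2)%R => n; rewrite hornerM E1 E2.
Qed.

Ltac polyfun_tac := repeat first
  [ assumption | exact: polyfun_const | exact: polyfun_id
  | apply: polyfun_add | apply: polyfun_mul
  | match goal with H : polyfun ?f |- polyfun (fun n => ?f _) =>
      apply: (polyfun_comp H) end ].

Notation "p ;; q" := (Seq p q) (at level 65, right associativity).

Definition run_le p s n s' := exists2 t, t <= n & run p s t s'.

Lemma run_le_weaken p s m n s' : m <= n -> run_le p s m s' -> run_le p s n s'.
Proof. by move=> le_mn [t le_t R]; exists t => //; apply: leq_trans le_mn. Qed.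

Lemma run_le_push i a s : run_le (Push i a) s 2 (set i (a :: get i s) s).
Proof. by exists 2 => //; constructor. Qed.

Lemma run_le_pop i s : run_le (Pop i) s 1 (set i (behead (get i s)) s).
Proof. by exists 1 => //; constructor. Qed.

Lemma run_le_seq p q s m s1 n s2 :
  run_le p s m s1 -> run_le q s1 n s2 -> run_le (p ;; q) s (m + n) s2.
Proof.
by move=> [t le_t R] [u le_u R']; exists (t + u); [exact: leq_add|apply: run_seq R R'].
Qed.

Lemma run_le_if_true i (b : option symb -> bool) p q s n s' : b (ohead (get i s)) ->
  run_le p s n s' -> run_le (If i b p q) s n.+1 s'.
Proof. by move=> Hb [t le_t R]; exists t.+1 => //; apply: run_if_true. Qed.

Lemma run_le_if_false i (b : option symb -> bool) p q s n s' : ~~ b (ohead (get i s)) ->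
  run_le q s n s' -> run_le (If i b p q) s n.+1 s'.
Proof. by move=> Hb [t le_t R]; exists t.+1 => //; apply: run_if_false. Qed.

Lemma run_le_while_stop i (b : option symb -> bool) p s : ~~ b (ohead (get i s)) ->
  run_le (While i b p) s 1 s.
Proof. by move=> Hb; exists 1 => //; apply: run_while_stop. Qed.

Lemma run_le_while_step i (b : option symb -> bool) p s m s1 n s2 :
  b (ohead (get i s)) -> run_le p s m s1 -> run_le (While i b p) s1 n s2 ->
  run_le (While i b p) s (m + n).+1 s2.
Proof.
move=> Hb [t le_t R] [u le_u R']; exists (t + u).+1; first by rewrite ltnS leq_add.
exact: run_while_step R R'.
Qed.

Inductive tree := Leaf | Node of tree & tree.

Notation one := (inr true : symb).
Notation zero := (inr false : symb).
Notation mark := (inl None : symb).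

(* Polish notation is a prefix code, so trees can be kept on a stack without
   separators. *)
Fixpoint code (t : tree) : seq symb :=
  if t is Node a b then one :: code a ++ code b else [:: zero].

Fixpoint tsize (t : tree) : nat :=
  if t is Node a b then (tsize a + tsize b).+1 else 1.

Lemma size_code t : size (code t) = tsize t.
Proof. by elim: t => //= a IHa b IHb; rewrite size_cat IHa IHb. Qed.

Lemma tsize_gt0 t : 0 < tsize t. Proof. by case: t. Qed.

Definition is_one (x : option symb) := x == Some one.

(** A node symbol replaces one outstanding tree by two, a leaf settles one; [tgt] says what to do
    with each symbol that is read. *)
Definition scan_loop (tgt : symb -> prog) :=
  While CtT isSome
    (If DtT is_one (Push CtT one ;; tgt one) (Pop CtT ;; tgt zero) ;; Pop DtT).

(* The stack [CtT] counts in unary the trees that remain to be read. *)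
Definition scan tgt := Push CtT one ;; scan_loop tgt.

Section Scan.
Variables (tgt : symb -> prog) (n0 : nat)
  (F : seq symb * seq symb -> symb -> seq symb * seq symb).
Hypothesis tgtP : forall a i d rs c,
  run_le (tgt a) (Store i d rs.1 rs.2 c) n0 (Store i d (F rs a).1 (F rs a).2 c).

(** Stated with the rest of the run as a hypothesis: after a node symbol the two subtrees are
    successive trees on the stack, and the induction hypotheses are chained through what follows
    them. *)
Lemma run_scan_loop t : forall i d rs c m s,
  run_le (scan_loop tgt)
    (Store i d (foldl F rs (code t)).1 (foldl F rs (code t)).2 c) m s ->
  run_le (scan_loop tgt) (Store i (code t ++ d) rs.1 rs.2 (one :: c))
    (m + (n0 + 6) * tsize t) s.
Proof.
elim: t => [|a IHa b IHb] i d rs c m s R.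
  have R1 : run_le (If DtT is_one (Push CtT one ;; tgt one) (Pop CtT ;; tgt zero) ;; Pop DtT)
      (Store i (zero :: d) rs.1 rs.2 (one :: c)) ((1 + n0).+1 + 1)
      (Store i d (F rs zero).1 (F rs zero).2 c).
    apply: run_le_seq (run_le_pop DtT (Store i (zero :: d) (F rs zero).1 (F rs zero).2 c)).
    apply: run_le_if_false => //; apply: run_le_seq (run_le_pop _ _) _.
    exact: tgtP.
  by apply: run_le_weaken (run_le_while_step _ R1 R) => //=; lia.
have R1 : run_le (If DtT is_one (Push CtT one ;; tgt one) (Pop CtT ;; tgt zero) ;; Pop DtT)
    (Store i (one :: code a ++ code b ++ d) rs.1 rs.2 (one :: c)) ((2 + n0).+1 + 1)
    (Store i (code a ++ code b ++ d) (F rs one).1 (F rs one).2 (one :: one :: c)).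
  apply: run_le_seq (run_le_pop DtT (Store i (one :: code a ++ code b ++ d) (F rs one).1 (F rs one).2 (one :: one :: c))).
  apply: run_le_if_true => //; apply: run_le_seq (run_le_push _ _ _) _.
  exact: tgtP.
have {}R : run_le (scan_loop tgt) (Store i (code a ++ code b ++ d) (F rs one).1 (F rs one).2 (one :: one :: c))
    ((m + (n0 + 6) * tsize b) + (n0 + 6) * tsize a) s.
  by apply/IHa/IHb; rewrite -foldl_cat.
rewrite /= -catA.
by apply: run_le_weaken (run_le_while_step _ R1 R) => //=; lia.
Qed.

Lemma run_scan t i d rs :
  run_le (scan tgt) (Store i (code t ++ d) rs.1 rs.2 [::]) (3 + (n0 + 6) * tsize t)
    (Store i d (foldl F rs (code t)).1 (foldl F rs (code t)).2 [::]).
Proof.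
have L : run_le (scan_loop tgt)
    (Store i d (foldl F rs (code t)).1 (foldl F rs (code t)).2 [::]) 1
    (Store i d (foldl F rs (code t)).1 (foldl F rs (code t)).2 [::]).
  exact: run_le_while_stop.
have {}L := run_scan_loop L.
by rewrite -[3]/(2 + 1) -addnA; apply: run_le_seq (run_le_push _ _ _) _; apply: L.
Qed.

End Scan.

Definition is_mark (x : option symb) := x == Some mark.

Definition unload (i : reg) :=
  While i (fun x => ~~ is_mark x)
    (If i is_one (Push DtT one) (Push DtT zero) ;; Pop i) ;; Pop i.

(** Moving symbols one at a time reverses the code. Reversed Polish notation is not a prefix code,
    hence the mark below it; unloading reverses once more. *)
Definition saved (t : tree) (r : seq symb) := rev (code t) ++ mark :: r.

Lemma code_bits t : all (fun x => (x == one) || (x == zero)) (code t).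
Proof. by elim: t => //= a IHa b IHb; rewrite all_cat IHa IHb. Qed.

Section Unload.
Variables (i : reg) (mk : seq symb -> seq symb -> store).
Hypotheses (get_src : forall d r, get i (mk d r) = r)
  (get_dst : forall d r, get DtT (mk d r) = d)
  (set_src : forall d r r', set i r' (mk d r) = mk d r')
  (set_dst : forall d r d', set DtT d' (mk d r) = mk d' r).

Lemma run_unload t d r :
  run_le (unload i) (mk d (saved t r)) (2 + 5 * tsize t) (mk (code t ++ d) r).
Proof.
rewrite /saved -[in code t ++ d](revK (code t)) -size_code -size_rev.
have : all (fun x => (x == one) || (x == zero)) (rev (code t)) by rewrite all_rev code_bits.
have pop d0 x r0 : run_le (Pop i) (mk d0 (x :: r0)) 1 (mk d0 r0).
  by have := run_le_pop i (mk d0 (x :: r0)); rewrite get_src set_src.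
elim: (rev (code t)) d => [|x u IH] d /=.
  move=> _; apply: (@run_le_weaken _ _ (1 + 1)) => //.
  by apply: run_le_seq (pop _ _ _); apply: run_le_while_stop; rewrite get_src.
case/andP=> Hx /IH{}IH.
(* The induction hypothesis covers the loop together with its final [Pop]. Inverting that run
   isolates the loop, so that one more iteration can be put in front of it. *)
have [m [n [s1 [E R1 R2]]]] : exists m n s1, [/\ m + n = 2 + 5 * size u,
    run_le (While i (fun x => ~~ is_mark x)
      (If i is_one (Push DtT one) (Push DtT zero) ;; Pop i))
      (mk (x :: d) (u ++ mark :: r)) m s1 &
    run_le (Pop i) s1 n (mk (rev (x :: u) ++ d) r)].
  have [t0 le_t R] := IH (x :: d).
  inversion R; subst.
  exists (2 + 5 * size u - u0), u0, s1; split; first by lia.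
    by exists t1 => //; lia.
  by exists u0 => //; rewrite rev_cons cat_rcons.
apply: (@run_le_weaken _ _ ((3 + 1 + m).+1 + n)); first by lia.
apply: run_le_seq R2; apply: run_le_while_step R1.
  by rewrite get_src; case/orP: Hx => /eqP->.
apply: run_le_seq; last exact: pop.
rewrite -(set_dst d _ (x :: d)) -[in x :: d](get_dst d (x :: u ++ mark :: r)).
case/orP: Hx => /eqP->.
  by apply: run_le_if_true; [rewrite get_src|exact: run_le_push].
by apply: run_le_if_false; [rewrite get_src|exact: run_le_push].
Qed.

End Unload.

Lemma run_unloadR t i d r s c :
  run_le (unload RtT) (Store i d (saved t r) s c) (2 + 5 * tsize t)
    (Store i (code t ++ d) r s c).
Proof. exact: (@run_unload RtT (fun d r => Store i d r s c)). Qed.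

Lemma run_unloadS t i d r s c :
  run_le (unload StT) (Store i d r (saved t s) c) (2 + 5 * tsize t)
    (Store i (code t ++ d) r s c).
Proof. exact: (@run_unload StT (fun d s => Store i d r s c)). Qed.

(** Pushing a symbol and popping it again serves as the empty instruction. *)
Definition dropT := scan (fun _ => Push RtT zero ;; Pop RtT).
Definition saveR := Push RtT mark ;; scan (Push RtT).
Definition saveS := Push StT mark ;; scan (Push StT).
Definition dupT := Push RtT mark ;; Push StT mark ;;
  scan (fun a => Push RtT a ;; Push StT a) ;; unload RtT ;; unload StT.

Lemma run_drop t i d r s :
  run_le dropT (Store i (code t ++ d) r s [::]) (20 * tsize t) (Store i d r s [::]).
Proof.
have H (a : symb) i0 d0 (rs : seq symb * seq symb) c :
    run_le (Push RtT zero ;; Pop RtT) (Store i0 d0 rs.1 rs.2 c) (2 + 1)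
      (Store i0 d0 rs.1 rs.2 c).
  by apply: run_le_seq (run_le_push _ _ _) _; exact: run_le_pop.
have := run_scan (tgt := fun _ => _) (F := fun rs (_ : symb) => rs) H t i d (r, s).
have -> : foldl (fun rs _ => rs) (r, s) (code t) = (r, s) by elim: (code t).
by apply: run_le_weaken; have := tsize_gt0 t; lia.
Qed.

Lemma run_saveR t i d r s :
  run_le saveR (Store i (code t ++ d) r s [::]) (20 * tsize t)
    (Store i d (saved t r) s [::]).
Proof.
have H a i0 d0 (rs : seq symb * seq symb) c :
    run_le (Push RtT a) (Store i0 d0 rs.1 rs.2 c) 2 (Store i0 d0 (a :: rs.1) rs.2 c).
  exact: run_le_push.
have := run_scan (F := fun rs a => (a :: rs.1, rs.2)) H t i d (mark :: r, s).
have -> : foldl (fun rs a => (a :: rs.1, rs.2)) (mark :: r, s) (code t) = (saved t r, s).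
  by rewrite /saved -catrevE; elim: (code t) (mark :: r) => //=.
move=> R; apply: (@run_le_weaken _ _ (2 + (3 + (2 + 6) * tsize t))).
  have := tsize_gt0 t; lia.
by apply: run_le_seq (run_le_push _ _ _) _; apply: R.
Qed.

Lemma run_saveS t i d r s :
  run_le saveS (Store i (code t ++ d) r s [::]) (20 * tsize t)
    (Store i d r (saved t s) [::]).
Proof.
have H a i0 d0 (rs : seq symb * seq symb) c :
    run_le (Push StT a) (Store i0 d0 rs.1 rs.2 c) 2 (Store i0 d0 rs.1 (a :: rs.2) c).
  exact: run_le_push.
have := run_scan (F := fun rs a => (rs.1, a :: rs.2)) H t i d (r, mark :: s).
have -> : foldl (fun rs a => (rs.1, a :: rs.2)) (r, mark :: s) (code t) = (r, saved t s).
  by rewrite /saved -catrevE; elim: (code t) (mark :: s) => //=.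
move=> R; apply: (@run_le_weaken _ _ (2 + (3 + (2 + 6) * tsize t))).
  have := tsize_gt0 t; lia.
by apply: run_le_seq (run_le_push _ _ _) _; apply: R.
Qed.

Lemma run_dup t i d r s :
  run_le dupT (Store i (code t ++ d) r s [::]) (60 * tsize t)
    (Store i (code t ++ code t ++ d) r s [::]).
Proof.
have H a i0 d0 (rs : seq symb * seq symb) c :
    run_le (Push RtT a ;; Push StT a) (Store i0 d0 rs.1 rs.2 c) (2 + 2)
      (Store i0 d0 (a :: rs.1) (a :: rs.2) c).
  by apply: run_le_seq (run_le_push _ _ _) _; exact: run_le_push.
have := run_scan (tgt := fun a => Push RtT a ;; Push StT a)
  (F := fun rs a => (a :: rs.1, a :: rs.2)) H t i d (mark :: r, mark :: s).
have -> : foldl (fun rs a => (a :: rs.1, a :: rs.2)) (mark :: r, mark :: s) (code t)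
    = (saved t r, saved t s).
  by rewrite /saved -!catrevE; elim: (code t) (mark :: r) (mark :: s) => //=.
move=> R; apply: (@run_le_weaken _ _ (2 + (2 + ((3 + (2 + 2 + 6) * tsize t) +
    ((2 + 5 * tsize t) + (2 + 5 * tsize t)))))).
  have := tsize_gt0 t; lia.
apply: run_le_seq (run_le_push _ _ _) _; apply: run_le_seq (run_le_push _ _ _) _.
apply: run_le_seq; first exact: R.
apply: run_le_seq; first exact: run_unloadR.
exact: run_unloadS.
Qed.

(** * Functions computable in polynomial time *)

Class encoding (X : Type) := enc : X -> tree.

Definition esize {X} {eX : encoding X} (x : X) : nat := tsize (enc x).

#[export] Instance enc_bool : encoding bool := fun b => if b then Node Leaf Leaf else Leaf.

#[export] Instance enc_prod X Y {eX : encoding X} {eY : encoding Y} : encoding (X * Y)%type :=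
  fun x => Node (enc x.1) (enc x.2).

Fixpoint enc_list X (eX : encoding X) (l : seq X) : tree :=
  if l is x :: l' then Node (enc x) (enc_list eX l') else Leaf.

#[export] Instance enc_seq X {eX : encoding X} : encoding (seq X) := enc_list eX.

(** The program must work above arbitrary data and leave the other stacks as they were; pairing and
    folds can therefore park intermediate results there. *)
Definition polytime {X Y} {eX : encoding X} {eY : encoding Y} (f : X -> Y) :=
  exists p P, polyfun P /\ forall x i d r s,
    run_le p (Store i (code (enc x) ++ d) r s [::]) (P (esize x))
      (Store i (code (enc (f x)) ++ d) r s [::]).

(** Each step adds at most one symbol, so a bound on the time is also a bound on the size of the
    result. *)
Lemma run_growth p s t s' : run p s t s' -> size (dtS s') <= size (dtS s) + t.
Proof.
elim=> {p s t s'}; try by move=> *; lia.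
- by move=> [] a [? ? ? ? ?] /=; lia.
- by move=> [] [? ? ? ? ?] /=; rewrite ?size_behead; lia.
Qed.

Lemma esize_pair X Y {eX : encoding X} {eY : encoding Y} (x : X) (y : Y) :
  esize (x, y) = (esize x + esize y).+1.
Proof. by []. Qed.

Lemma esize_cons X {eX : encoding X} (x : X) (l : seq X) :
  esize (x :: l) = (esize x + esize l).+1.
Proof. by []. Qed.

Lemma esize_cat X {eX : encoding X} (l1 l2 : seq X) :
  (esize (l1 ++ l2)).+1 = esize l1 + esize l2.
Proof. by elim: l1 => //= x l1 IH; rewrite !esize_cons addSn -addnA -IH addnS. Qed.

Lemma size_le_esize X {eX : encoding X} (l : seq X) : size l < esize l.
Proof. by elim: l => //= x l IH; rewrite esize_cons; lia. Qed.

Lemma esize_gt0 X {eX : encoding X} (x : X) : 0 < esize x.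
Proof. exact: tsize_gt0. Qed.

Lemma code_pair X Y {eX : encoding X} {eY : encoding Y} (x : X) (y : Y) :
  code (enc (x, y)) = one :: code (enc x) ++ code (enc y).
Proof. by []. Qed.

Lemma code_cons X {eX : encoding X} (x : X) (l : seq X) :
  code (enc (x :: l)) = one :: code (enc x) ++ code (enc l).
Proof. by []. Qed.

Section Basic.
Context {X Y Z : Type} {eX : encoding X} {eY : encoding Y} {eZ : encoding Z}.

Lemma polytime_size (f : X -> Y) : polytime f ->
  exists P, polyfun P /\ forall x, esize (f x) <= P (esize x).
Proof.
move=> [p [P [HP H]]]; exists (fun n => n + P n); split; first by polyfun_tac.
move=> x; have [t le_t /run_growth /=] := H x [::] [::] [::] [::].
by rewrite !cats0 !size_code /esize in le_t * => le2; apply: leq_trans le2 _; rewrite leq_add2l.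
Qed.

(** Only the encoded result matters. This replaces a function by an equal one that is easier to
    compute, or by one into another type with the same trees, as for numbers and their digit
    lists. *)
Lemma polytime_recode (g : X -> Z) (f : X -> Y) :
  (forall x, enc (f x) = enc (g x)) -> polytime g -> polytime f.
Proof.
by move=> E [p [P [HP H]]]; exists p, P; split=> // *; rewrite E; apply: H.
Qed.

Lemma polytime_comp (f : Y -> Z) (g : X -> Y) :
  polytime f -> polytime g -> polytime (fun x => f (g x)).
Proof.
move=> pf pg; have [Q [HQ HQs]] := polytime_size pg.
case: pf pg => [p [P [HP H]]] [q [R [HR HqR]]].
exists (q ;; p), (fun n => R n + P (Q n)); split; first by polyfun_tac.
move=> x i d r s; apply: run_le_seq; first exact: HqR.
by apply: run_le_weaken (H _ _ _ _ _); apply: polyfun_mono.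
Qed.

Lemma polytime_pair (f : X -> Y) (g : X -> Z) :
  polytime f -> polytime g -> polytime (fun x => (f x, g x)).
Proof.
move=> pf pg; have [Q [HQ HQs]] := polytime_size pf.
case: pf pg => [p [P [HP H]]] [q [R [HR HqR]]].
exists (dupT ;; p ;; saveR ;; q ;; unload RtT ;; Push DtT one),
  (fun n => 60 * n + (P n + (20 * Q n + (R n + (2 + 5 * Q n + 2))))).
split; first by polyfun_tac.
move=> x i d r s.
apply: run_le_seq; first exact: run_dup.
apply: run_le_seq; first exact: H.
apply: run_le_seq; first by apply: run_le_weaken (run_saveR _ _ _ _ _); rewrite leq_mul2l HQs.
apply: run_le_seq; first exact: HqR.
apply: run_le_seq.
  by apply: run_le_weaken (run_unloadR _ _ _ _ _ _); rewrite leq_add2l leq_mul2l HQs.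
have := run_le_push DtT one (Store i (code (enc (f x)) ++ code (enc (g x)) ++ d) r s [::]).
by rewrite /= -catA.
Qed.

Lemma polytime_id : polytime (fun x : X => x).
Proof.
exists (Push RtT zero ;; Pop RtT), (fun _ => 3); split; first by polyfun_tac.
by move=> x i d r s; apply: run_le_seq (run_le_push _ _ _) _; exact: run_le_pop.
Qed.

End Basic.

Fixpoint push_all (u : seq symb) : prog :=
  if u is a :: u' then push_all u' ;; Push DtT a else Push RtT zero ;; Pop RtT.

Lemma run_push_all u i d r s :
  run_le (push_all u) (Store i d r s [::]) (3 + 2 * size u) (Store i (u ++ d) r s [::]).
Proof.
elim: u => [|a u IH] /=.
  by apply: (@run_le_weaken _ _ (2 + 1)) => //;
     apply: run_le_seq (run_le_push _ _ _) _; exact: run_le_pop.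
apply: (@run_le_weaken _ _ ((3 + 2 * size u) + 2)); first by lia.
by apply: run_le_seq IH _; exact: run_le_push.
Qed.

Section Components.
Context {X Y Z : Type} {eX : encoding X} {eY : encoding Y} {eZ : encoding Z}.

Lemma polytime_fst (f : X -> Y * Z) : polytime f -> polytime (fun x => (f x).1).
Proof.
apply: polytime_comp.
exists (Pop DtT ;; saveR ;; dropT ;; unload RtT),
  (fun n => 1 + (20 * n + (20 * n + (2 + 5 * n)))); split; first by polyfun_tac.
move=> [y z] i d r s.
rewrite esize_pair code_pair /= -catA /esize.
apply: run_le_seq (run_le_pop _ _) _.
apply: run_le_seq; first by apply: run_le_weaken (run_saveR _ _ _ _ _); lia.
apply: run_le_seq; first by apply: run_le_weaken (run_drop _ _ _ _ _); lia.
by apply: run_le_weaken (run_unloadR _ _ _ _ _ _); lia.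
Qed.

Lemma polytime_snd (f : X -> Y * Z) : polytime f -> polytime (fun x => (f x).2).
Proof.
apply: polytime_comp.
exists (Pop DtT ;; dropT), (fun n => 1 + 20 * n); split; first by polyfun_tac.
move=> [y z] i d r s.
rewrite esize_pair code_pair /= -catA /esize.
apply: run_le_seq (run_le_pop _ _) _.
by apply: run_le_weaken (run_drop _ _ _ _ _); lia.
Qed.

Lemma polytime_const (y : Y) : polytime (fun _ : X => y).
Proof.
exists (dropT ;; push_all (code (enc y))), (fun n => 20 * n + (3 + 2 * size (code (enc y)))).
split; first by polyfun_tac.
move=> x i d r s; apply: run_le_seq; first exact: run_drop.
exact: run_push_all.
Qed.

Lemma polytime_if (b : X -> bool) (f g : X -> Y) : polytime b -> polytime f -> polytime g ->
  polytime (fun x => if b x then f x else g x).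
Proof.
move=> [q [Q [HQ Hq]]] [p [P [HP H]]] [p' [P' [HP' H']]].
exists (dupT ;; q ;; If DtT is_one (dropT ;; p) (dropT ;; p')),
  (fun n => 60 * n + (Q n + ((60 + P n + P' n) + 1))); split; first by polyfun_tac.
move=> x i d r s; apply: run_le_seq; first exact: run_dup.
apply: run_le_seq; first exact: Hq.
rewrite addn1; case: (b x).
  apply: run_le_if_true => //.
  (* The tree of [true] has three symbols, that of [false] one. *)
  apply: (@run_le_weaken _ _ (20 * 3 + P (esize x))); first lia.
  by apply: run_le_seq (H _ _ _ _ _); apply: (run_drop (enc true)).
apply: run_le_if_false => //.
apply: (@run_le_weaken _ _ (20 * 1 + P' (esize x))); first lia.
by apply: run_le_seq (H' _ _ _ _ _); apply: (run_drop (enc false)).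
Qed.

Lemma polytime_nilp (l : X -> seq Y) : polytime l -> polytime (fun x => nilp (l x)).
Proof.
apply: polytime_comp.
exists (If DtT is_one (dropT ;; push_all (code (enc false)))
          (dropT ;; push_all (code (enc true)))),
  (fun n => (20 * n + 9) + 1); split; first by polyfun_tac.
move=> [|y u] i d r s; rewrite addn1.
  apply: run_le_if_false => //.
  apply: run_le_seq (run_push_all (code (enc true)) _ _ _ _).
  exact: (run_drop (enc [::])).
apply: run_le_if_true => //.
apply: (@run_le_weaken _ _ (20 * esize (y :: u) + 5)); first by lia.
apply: run_le_seq (run_push_all (code (enc false)) _ _ _ _).
exact: (run_drop (enc (y :: u))).
Qed.

Lemma polytime_cons (a : X -> Y) (l : X -> seq Y) : polytime a -> polytime l ->
  polytime (fun x => a x :: l x).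
Proof. by move=> pa pl; apply: polytime_recode (polytime_pair pa pl). Qed.

Lemma polytime_behead (l : X -> seq Y) : polytime l -> polytime (fun x => behead (l x)).
Proof.
apply: polytime_comp.
exists (If DtT is_one (Pop DtT ;; dropT) (Push RtT zero ;; Pop RtT)),
  (fun n => (3 + 20 * n) + 1); split; first by polyfun_tac.
move=> [|y u] i d r s; rewrite addn1.
  apply: run_le_if_false => //; apply: (@run_le_weaken _ _ (2 + 1)) => //.
  by apply: run_le_seq (run_le_push _ _ _) _; exact: run_le_pop.
apply: run_le_if_true => //.
rewrite esize_cons code_cons /= -catA /esize.
apply: (@run_le_weaken _ _ (1 + 20 * tsize (enc y))); first by lia.
by apply: run_le_seq (run_le_pop _ _) _; apply: run_drop.
Qed.

Lemma polytime_head (y0 : Y) (l : X -> seq Y) : polytime l ->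
  polytime (fun x => head y0 (l x)).
Proof.
apply: polytime_comp.
set n0 := 3 + 2 * size (code (enc y0)).
exists (If DtT is_one (Pop DtT ;; saveR ;; dropT ;; unload RtT)
   (dropT ;; push_all (code (enc y0)))),
  (fun n => (3 + 45 * n + n0) + 1); split; first by polyfun_tac.
move=> [|y u] i d r s; rewrite addn1.
  apply: run_le_if_false => //.
  apply: (@run_le_weaken _ _ (20 * 1 + n0)).
    by have -> : esize ([::] : seq Y) = 1 by []; lia.
  apply: run_le_seq (run_push_all _ _ _ _ _).
  exact: (run_drop (enc [::])).
apply: run_le_if_true => //.
rewrite esize_cons code_cons /= -catA /esize.
apply: (@run_le_weaken _ _ (1 + (20 * tsize (enc y) + (20 * tsize (enc u) + (2 + 5 * tsize (enc y)))))).
  by lia.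
apply: run_le_seq (run_le_pop _ _) _.
apply: run_le_seq; first exact: run_saveR.
apply: run_le_seq; first exact: run_drop.
exact: run_unloadR.
Qed.

End Components.

(** * Folds with polynomially bounded accumulators *)

Section Fold.
Context {X A S : Type} {eX : encoding X} {eA : encoding A} {eS : encoding S}.
Variables (h : X -> S -> A -> S) (s0 : X -> S) (l : X -> seq A).

(** The bound [Q] is needed on all prefixes: a step of polynomial cost may double its accumulator,
    which would make the later steps exponential. *)
Lemma polytime_foldl Q : polyfun Q ->
  (forall x l1 l2, l x = l1 ++ l2 -> esize (foldl (h x) (s0 x) l1) <= Q (esize x)) ->
  polytime (fun y : X * S * A => h y.1.1 y.1.2 y.2) -> polytime s0 -> polytime l ->
  polytime (fun x => foldl (h x) (s0 x) (l x)).
Proof.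
move=> HQ Qs ph ps pl; have [L [HL Ls]] := polytime_size pl.
(* The argument comes in this order because the current element is put back directly above the
   stored pair of [x] and accumulator; one further [one] then makes a pair of them without moving
   data. *)
have pstep : polytime (fun y : A * (X * S) => (y.2.1, h y.2.1 y.2.2 y.1)).
  have p1 : polytime (fun y : A * (X * S) => y.2.1).
    by apply: polytime_fst; apply: polytime_snd; apply: polytime_id.
  apply: polytime_pair => //.
  apply: (polytime_comp (g := fun y : A * (X * S) => (y.2.1, y.2.2, y.1)) ph).
  apply: polytime_pair; last by apply: polytime_fst; apply: polytime_id.
  by apply: polytime_pair => //; apply: polytime_snd; apply: polytime_snd; apply: polytime_id.
have pinit : polytime (fun x => (l x, (x, s0 x))).
  by apply: polytime_pair => //; apply: polytime_pair => //; apply: polytime_id.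
apply: (polytime_snd (f := fun x => (x, foldl (h x) (s0 x) (l x)))).
case: pstep pinit => [p [P [HP Hp]]] [q [R [HR Hq]]].
(* Element and rest of the list are set aside on two stacks, the element is put back and paired with
   the state, and the rest returns after the step. *)
pose loop := While DtT is_one (Pop DtT ;; saveR ;; saveS ;; unload RtT ;;
                               Push DtT one ;; p ;; unload StT).
(* One pass costs at most [N]; the argument of [P] bounds the size of the element, [x], the
   accumulator and the two pairing nodes. *)
pose N n := 1 + (20 * L n + (20 * L n + ((2 + 5 * L n) + (2 +
  (P (L n + n + Q n + 2) + (2 + 5 * L n)))))).
(* The first [Pop] opens the pair of list and state, the last removes the leaf of the exhausted
   list. *)
exists (q ;; Pop DtT ;; loop ;; Pop DtT), (fun n => R n + (1 + ((L n * (1 + N n) + 1) + 1))).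
split; first by rewrite /N; polyfun_tac.
move=> x i d r s; apply: run_le_seq; first exact: Hq.
(* Loop invariant: [l1] has been processed, and [l2] lies above [x] and the accumulator. *)
have Hloop l2 l1 : l x = l1 ++ l2 -> run_le loop
    (Store i (code (enc l2) ++ code (enc (x, foldl (h x) (s0 x) l1)) ++ d) r s [::])
    (size l2 * (1 + N (esize x)) + 1)
    (Store i (zero :: code (enc (x, foldl (h x) (s0 x) (l x))) ++ d) r s [::]).
  elim: l2 l1 => [|a l2 IH] l1 El; first by rewrite El cats0; apply: run_le_while_stop.
  have El' : l x = rcons l1 a ++ l2 by rewrite cat_rcons.
  have {IH} := IH _ El'; rewrite foldl_rcons.
  have la : esize a + esize l2 < L (esize x).
    apply: leq_trans (Ls x); rewrite El; have := esize_cat (eX := eA) l1 (a :: l2).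
    by rewrite esize_cons; have := esize_gt0 (eX := @enc_seq A eA) l1; lia.
  set f := foldl _ _ l1; move=> IH.
  have fQ : esize f <= Q (esize x) by apply: Qs El.
  have -> : size (a :: l2) * (1 + N (esize x)) + 1 =
    (N (esize x) + (size l2 * (1 + N (esize x)) + 1)).+1 by rewrite /= mulSn; lia.
  apply: run_le_while_step IH => //.
  have -> : code (enc (a :: l2)) ++ code (enc (x, f)) ++ d =
    one :: code (enc a) ++ code (enc l2) ++ code (enc (x, f)) ++ d.
    by rewrite code_cons /= -catA.
  apply: run_le_seq (run_le_pop _ _) _.
  have la1 : tsize (enc a) <= L (esize x) by apply: leq_trans (ltnW la); apply: leq_addr.
  have la2 : tsize (enc l2) <= L (esize x) by apply: leq_trans (ltnW la); apply: leq_addl.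
  apply: run_le_seq; first by apply: run_le_weaken (run_saveR _ _ _ _ _); rewrite leq_mul2l la1.
  apply: run_le_seq; first by apply: run_le_weaken (run_saveS _ _ _ _ _); rewrite leq_mul2l la2.
  apply: run_le_seq.
    by apply: run_le_weaken (run_unloadR _ _ _ _ _ _); rewrite leq_add2l leq_mul2l la1.
  apply: run_le_seq (run_le_push _ _ _) _.
  apply: run_le_seq.
    set sl := saved (enc l2) s; have := Hp (a, (x, f)) i d r sl.
    have -> : code (enc (a, (x, f))) ++ d = one :: code (enc a) ++ code (enc (x, f)) ++ d.
      by rewrite (code_pair a) cat_cons -catA.
    move=> R1; apply: run_le_weaken R1; apply: polyfun_mono => //.
    by rewrite !esize_pair; lia.
  by apply: run_le_weaken (run_unloadS _ _ _ _ _ _); rewrite leq_add2l leq_mul2l la2.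
rewrite code_pair /= -catA; apply: run_le_seq (run_le_pop _ _) _.
apply: run_le_seq; last first.
  exact: (run_le_pop _ (Store i (zero :: code (enc (x, foldl (h x) (s0 x) (l x))) ++ d) _ _ _)).
apply: run_le_weaken (Hloop (l x) [::] erefl).
by rewrite leq_add2r leq_mul2r (leq_trans (ltnW (size_le_esize _)) (Ls x)) orbT.
Qed.

(** If a step adds an amount that does not depend on the accumulator, the growth is at most the
    number of steps times that amount. *)
Lemma polytime_foldl_additive B : polyfun B ->
  (forall x s a, esize (h x s a) <= esize s + B (esize x + esize a)) ->
  polytime (fun y : X * S * A => h y.1.1 y.1.2 y.2) -> polytime s0 -> polytime l ->
  polytime (fun x => foldl (h x) (s0 x) (l x)).
Proof.
move=> HB Hh ph ps pl.
have [L [HL Ls]] := polytime_size pl; have [Q0 [HQ0 Qs]] := polytime_size ps.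
apply: (@polytime_foldl (fun n => Q0 n + L n * B (n + L n))) => //.
  by polyfun_tac; apply: (polyfun_comp HB); polyfun_tac.
move=> x l1 l2 El.
have le1 : size l1 <= L (esize x).
  apply: leq_trans (Ls x); apply: leq_trans (ltnW (size_le_esize _)).
  by rewrite El size_cat leq_addr.
have le2 : esize (foldl (h x) (s0 x) l1) <= esize (s0 x) + size l1 * B (esize x + L (esize x)); last first.
  apply: leq_trans le2 _; apply: leq_add => //; rewrite leq_mul2r le1 orbT //.
have : forall a, a \in [seq esize b | b <- l1] -> a <= L (esize x).
  move=> a al; apply: leq_trans (Ls x); rewrite El.
  elim: l1 al {El le1} => //= b l1 IH; rewrite inE esize_cons => /orP[/eqP->|/IH]; lia.
elim: l1 (s0 x) {El le1} => [|a l1 IH] s Hl /=; first by rewrite mul0n addn0.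
have {}IH := IH (h x s a); apply: leq_trans (IH _) _.
  by move=> b bl; apply: Hl; rewrite inE bl orbT.
rewrite mulSn addnA leq_add2r; apply: leq_trans (Hh _ _ _) _.
rewrite leq_add2l; apply: polyfun_mono => //; rewrite leq_add2l; apply: Hl.
by rewrite inE eqxx.
Qed.

End Fold.

(** * Lists *)

Ltac pt_ext := fail.
Ltac pt := repeat first
  [ assumption
  | simple apply polytime_const
  | simple apply polytime_id
  | pt_ext
  | simple apply polytime_if
  | simple apply polytime_pair
  | simple apply polytime_cons
  | simple apply polytime_nilp
  | simple apply polytime_behead
  | simple apply polytime_head
  | simple apply polytime_fst
  | simple apply polytime_snd ].

Section Lists.
Context {X A B : Type} {eX : encoding X} {eA : encoding A} {eB : encoding B}.

Lemma polytime_andb (b c : X -> bool) : polytime b -> polytime c ->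
  polytime (fun x => b x && c x).
Proof.
by move=> pb pc; apply: polytime_recode (polytime_if pb pc (polytime_const false)) => x;
  case: (b x).
Qed.

Lemma polytime_negb (b : X -> bool) : polytime b -> polytime (fun x => ~~ b x).
Proof.
by move=> pb; apply: polytime_recode (polytime_if pb (polytime_const false) (polytime_const true))
  => x; case: (b x).
Qed.

Lemma polytime_catrev (l1 l2 : X -> seq A) : polytime l1 -> polytime l2 ->
  polytime (fun x => catrev (l1 x) (l2 x)).
Proof.
move=> p1 p2.
apply: (polytime_recode (g := fun x => foldl (fun s a => a :: s) (l2 x) (l1 x))).
  by move=> x; elim: (l1 x) (l2 x) => //=.
apply: (polytime_foldl_additive (h := fun _ s a => a :: s) (B := fun n => n + 1)) => //.
- by polyfun_tac.
- by move=> x s a; rewrite esize_cons; lia.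
by pt.
Qed.

Lemma polytime_rev (l : X -> seq A) : polytime l -> polytime (fun x => rev (l x)).
Proof. by move=> pl; apply: polytime_catrev => //; pt. Qed.

End Lists.

Section Lists2.
Context {X A B : Type} {eX : encoding X} {eA : encoding A} {eB : encoding B}.

Lemma polytime_cat (l1 l2 : X -> seq A) : polytime l1 -> polytime l2 ->
  polytime (fun x => l1 x ++ l2 x).
Proof.
move=> p1 p2; apply: (polytime_recode (g := fun x => catrev (rev (l1 x)) (l2 x))).
  by move=> x; rewrite catrevE revK.
by apply: polytime_catrev => //; apply: polytime_rev.
Qed.

Lemma polytime_filter (p : X -> A -> bool) (l : X -> seq A) :
  polytime (fun y : X * A => p y.1 y.2) -> polytime l ->
  polytime (fun x => filter (p x) (l x)).
Proof.
move=> pp pl; apply: (polytime_recode (g := fun x =>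
    rev (foldl (fun s a => if p x a then a :: s else s) [::] (l x)))) => [x|].
  congr enc; rewrite -[LHS]revK; congr rev; rewrite /rev.
  by elim: (l x) [::] => //= a u IH s; rewrite -IH; case: (p x a).
apply: polytime_rev.
apply: (polytime_foldl_additive (B := fun n => n + 1)
  (h := fun x s a => if p x a then a :: s else s)) => //; first by polyfun_tac.
  by move=> x s a; case: (p x a); rewrite ?esize_cons; lia.
  2: by pt.
pt.
by apply: (polytime_comp (g := fun y : X * seq A * A => (y.1.1, y.2)) pp); pt.
Qed.

Lemma polytime_map (f : X -> A -> B) (l : X -> seq A) :
  polytime (fun y : X * A => f y.1 y.2) -> polytime l ->
  polytime (fun x => map (f x) (l x)).
Proof.
move=> pf pl; have [P [HP Ps]] := polytime_size pf.
apply: (polytime_recode (g := fun x =>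
    rev (foldl (fun s a => f x a :: s) [::] (l x)))) => [x|].
  congr enc; rewrite -[LHS]revK; congr rev; rewrite /rev.
  by elim: (l x) [::] => //= a u IH s; rewrite -IH.
apply: polytime_rev.
apply: (polytime_foldl_additive (B := fun n => P (n + 1) + 1)
  (h := fun x s a => f x a :: s)) => //.
- by polyfun_tac; apply: (polyfun_comp HP); polyfun_tac.
- move=> x s a; rewrite esize_cons addn1.
  have := Ps (x, a); rewrite esize_pair addn1 /=; lia.
- pt; by apply: (polytime_comp (g := fun y : X * seq B * A => (y.1.1, y.2)) pf); pt.
by pt.
Qed.

Lemma polytime_all (p : X -> A -> bool) (l : X -> seq A) :
  polytime (fun y : X * A => p y.1 y.2) -> polytime l ->
  polytime (fun x => all (p x) (l x)).
Proof.
move=> pp pl; apply: (polytime_recode (g := fun x => nilp (filter (fun a => ~~ p x a) (l x)))) => [x|].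
  by congr enc; rewrite /nilp size_filter eqn0Ngt -has_count has_predC negbK.
apply: polytime_nilp; apply: (polytime_filter (p := fun x a => ~~ p x a)) => //.
exact: polytime_negb.
Qed.

Lemma polytime_zip (d : B) (l1 : X -> seq A) (l2 : X -> seq B) :
  polytime l1 -> polytime l2 -> polytime (fun x => zip (l1 x) (l2 x)).
Proof.
move=> p1 p2; apply: (polytime_recode (g := fun x => rev (foldl (fun s a =>
   if nilp s.1 then s else (behead s.1, (a, head d s.1) :: s.2))
   (l2 x, [::]) (l1 x)).2)) => [x|].
  congr enc; rewrite -[LHS]revK; congr rev; rewrite /rev.
  elim: (l1 x) (l2 x) [::] => //= [|a u IH] [|b v] s //=.
  by elim: u {IH} => //=.
apply: polytime_rev; apply: polytime_snd.
apply: (polytime_foldl_additive (B := fun n => n + 2) (h := fun _ s a =>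
   if nilp s.1 then s else (behead s.1, (a, head d s.1) :: s.2))) => //.
- by polyfun_tac.
- move=> x [[|b v] s] a; rewrite /= ?esize_pair ?esize_cons ?esize_pair /=; lia.
all: by pt.
Qed.

End Lists2.

(** * Binary arithmetic *)

(** The size is governed by the number of digits and not by the value; parity, halving and the zero
    test are operations at the head of the digit list. *)
#[export] Instance enc_nat : encoding nat := fun n => enc (binary n).

Definition nbits n := size (binary n).

Lemma binaryE n : binary n = if n == 0 then [::] else odd n :: binary n./2.
Proof.
rewrite /binary; case: n => [|n]; first by rewrite up_log1.
rewrite /= up_log2S //= -[1]addn0 iotaDl -map_comp expn0 divn1; congr (_ :: _).
by apply: eq_map => e /=; rewrite expnS divnMA divn2.
Qed.

Lemma ltn_nbits n : n < 2 ^ nbits n.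
Proof. by rewrite /nbits size_map size_iota; apply: up_logP. Qed.

Lemma nbits_min n k : n < 2 ^ k -> nbits n <= k.
Proof. by rewrite /nbits size_map size_iota; apply: up_log_min. Qed.

Lemma esize_nil X {eX : encoding X} : esize ([::] : seq X) = 1. Proof. by []. Qed.

Lemma esize_natE n : esize n = esize (binary n). Proof. by []. Qed.

(** A bit takes at most three symbols and its list node one, hence the factor 4. *)
Lemma esize_nat n : nbits n < esize n <= 4 * nbits n + 1.
Proof.
rewrite esize_natE size_le_esize /nbits.
elim: (binary n) => // b u IH; rewrite esize_cons /= in IH *.
have : 0 < esize b <= 3 by case: b.
lia.
Qed.

Lemma esize_nat_pow n k : n < 2 ^ k -> esize n <= 4 * k + 1.
Proof. by move=> /nbits_min le_k; have := esize_nat n; lia. Qed.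

Definition cons_bit (b : bool) (n : nat) := b + n.*2.

Lemma binary_cons_bit b n :
  binary (cons_bit b n) = if b || (n != 0) then b :: binary n else [::].
Proof.
rewrite binaryE /cons_bit addn_eq0 double_eq0.
by case: b n => -[|n] //=; rewrite ?oddD ?odd_double ?uphalf_double ?doubleK.
Qed.

Lemma esize_cons_bit b n : esize (cons_bit b n) <= esize n + 4.
Proof.
rewrite !esize_natE binary_cons_bit.
have : 0 < esize b <= 3 by case: b.
have pos : 0 < esize (binary n) by exact: esize_gt0.
by case: ifP => _; rewrite ?esize_cons ?esize_nil; lia.
Qed.

Lemma cons_bit_half n : cons_bit (odd n) n./2 = n.
Proof. exact: odd_double_half. Qed.

Section Arith.
Context {X : Type} {eX : encoding X}.
Implicit Types a b : X -> nat.

Lemma polytime_binary a : polytime a -> polytime (fun x => binary (a x)).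
Proof. exact: polytime_recode. Qed.

Lemma polytime_odd a : polytime a -> polytime (fun x => odd (a x)).
Proof.
move=> pa; apply: (polytime_recode (g := fun x => head false (binary (a x)))).
  by move=> x; rewrite binaryE; case: (a x).
by apply: polytime_head; apply: polytime_binary.
Qed.

Lemma polytime_half a : polytime a -> polytime (fun x => (a x)./2).
Proof.
move=> pa; apply: (polytime_recode (g := fun x => behead (binary (a x)))).
  by move=> x; rewrite [in RHS]binaryE; case: (a x).
by apply: polytime_behead; apply: polytime_binary.
Qed.

Lemma polytime_eq0 a : polytime a -> polytime (fun x => a x == 0).
Proof.
move=> pa; apply: (polytime_recode (g := fun x => nilp (binary (a x)))).
  by move=> x; rewrite binaryE; case: (a x).
by apply: polytime_nilp; apply: polytime_binary.
Qed.

Lemma polytime_cons_bit (c : X -> bool) a : polytime c -> polytime a ->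
  polytime (fun x => cons_bit (c x) (a x)).
Proof.
move=> pc pa; apply: (polytime_recode (g := fun x =>
  if c x then c x :: binary (a x) else if a x == 0 then [::] else c x :: binary (a x))).
  by move=> x; rewrite /enc /enc_nat binary_cons_bit; case: (c x) (a x) => -[].
have pb : polytime (fun x => c x :: binary (a x)).
  by apply: polytime_cons => //; apply: polytime_binary.
apply: polytime_if => //; apply: polytime_if => //; first exact: polytime_eq0.
exact: polytime_const.
Qed.

Lemma polytime_xor (c d : X -> bool) : polytime c -> polytime d ->
  polytime (fun x => c x (+) d x).
Proof.
move=> pc pd; apply: (polytime_recode (g := fun x => if c x then ~~ d x else d x)).
  by move=> x; case: (c x).
by apply: polytime_if => //; apply: polytime_negb.
Qed.

End Arith.

Ltac pt_ext ::= first
 [ simple apply polytime_andb | simple apply polytime_negb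
 | simple apply polytime_xor
 | simple apply polytime_binary | simple apply polytime_odd | simple apply polytime_half
 | simple apply polytime_eq0 | simple apply polytime_cons_bit
 | simple apply polytime_cat | simple apply polytime_rev ].

(** Horner's scheme with the most significant digit first; [n] is the value of the digits read
    before. *)
Definition of_bits (u : seq bool) (n : nat) := foldl (fun n b => cons_bit b n) n u.

Lemma esize_of_bits u n : esize (of_bits u n) < esize n + esize u.
Proof.
elim: u n => [|b u IH] n; first by rewrite addn1.
apply: leq_trans (IH _) _; rewrite esize_cons addnS -addSn addnA leq_add2r.
rewrite !esize_natE binary_cons_bit.
have : 0 < esize b <= 3 by case: b.
have pos : 0 < esize (binary n) by exact: esize_gt0.
by case: ifP => _; rewrite ?esize_cons ?esize_nil; lia.
Qed.

(* Remaining parts of the summands, carry, and the sum bits found so far, most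
   significant first. *)
Definition add_step (s : nat * nat * (bool * seq bool)) : nat * nat * (bool * seq bool) :=
  (s.1.1./2, s.1.2./2,
   (if odd s.1.1 then (if odd s.1.2 then true else s.2.1)
    else if odd s.1.2 then s.2.1 else false,
    (odd s.1.1 (+) odd s.1.2 (+) s.2.1) :: s.2.2)).

(** The entries of [u] are ignored: its length is the number of rounds, which must cover all digits
    of both summands. The last carry becomes the leading digit of the sum. *)
Lemma add_stepP u a b c v : a < 2 ^ size u -> b < 2 ^ size u ->
  let s := foldl (fun s (_ : bool) => add_step s) (a, b, (c, v)) u in
  of_bits s.2.2 s.2.1 = of_bits v (c + a + b).
Proof.
elim: u a b c v => [|x u IH] a b c v /=.
  by rewrite expn0 !ltnS !leqn0 => /eqP-> /eqP->; rewrite !addn0.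
rewrite expnS => Ha Hb; have half_lt k : k < 2 * 2 ^ size u -> k./2 < 2 ^ size u.
  by rewrite -{1}(odd_double_half k); lia.
rewrite [LHS]IH ?half_lt //.
rewrite /of_bits /= /cons_bit; congr foldl.
move: (odd_double_half a) (odd_double_half b).
by case: (odd a) (odd b) c => [] [] [] /=; lia.
Qed.

Section Add.
Context {X : Type} {eX : encoding X}.
Implicit Types a b : X -> nat.

Lemma polytime_of_bits (u : X -> seq bool) a : polytime u -> polytime a ->
  polytime (fun x => of_bits (u x) (a x)).
Proof.
move=> pu pa.
apply: (polytime_foldl_additive (B := fun _ => 4) (h := fun _ n c => cons_bit c n)) => //.
- by polyfun_tac.
- by move=> x s b; apply: esize_cons_bit.
by pt.
Qed.

Lemma polytime_addn a b : polytime a -> polytime b -> polytime (fun x => a x + b x).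
Proof.
move=> pa pb.
pose s x := foldl (fun s (_ : bool) => add_step s) (a x, b x, (false, [::]))
  (binary (a x) ++ binary (b x)).
apply: (polytime_recode (g := fun x => of_bits (s x).2.2 (s x).2.1)) => [x|].
  congr enc; rewrite /s add_stepP //; rewrite size_cat expnD.
    by apply: leq_trans (ltn_nbits _) _; rewrite leq_pmulr ?expn_gt0.
  by apply: leq_trans (ltn_nbits _) _; rewrite leq_pmull ?expn_gt0.
have ps : polytime s.
  apply: (polytime_foldl_additive (B := fun _ => 8) (h := fun _ s (_ : bool) => add_step s)).
  - by polyfun_tac.
  - move=> _ [[m n] [c v]] _; rewrite /add_step /= !esize_pair esize_cons.
    have halfP k : esize k./2 <= esize k.
      rewrite !esize_natE [in leqRHS]binaryE; case: k => // k.
      by rewrite esize_cons; lia.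
    have := halfP m; have := halfP n.
    have eb (y : bool) : 0 < esize y <= 3 by case: y.
    move: (eb (if odd m then if odd n then true else c else if odd n then c else false))
      (eb (odd m (+) odd n (+) c)) (eb c); lia.
  - by rewrite /add_step; pt.
  - by pt.
  by pt.
apply: polytime_of_bits; first by pt.
apply: (polytime_recode (g := fun x => if (s x).2.1 then 1 else 0)); last by pt.
by move=> x; case: (s x).2.1.
Qed.

End Add.

Ltac pt_ext ::= first
 [ simple apply polytime_andb | simple apply polytime_negb | simple apply polytime_xor
 | simple apply polytime_binary | simple apply polytime_odd | simple apply polytime_half
 | simple apply polytime_eq0 | simple apply polytime_cons_bit
 | simple apply polytime_cat | simple apply polytime_rev
 | simple apply polytime_of_bits | simple apply polytime_addn ].

(* Bits are compared from the least significant one, so the last difference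
   decides. *)
Definition leq_step (s : nat * nat * bool) : nat * nat * bool :=
  (s.1.1./2, s.1.2./2, if odd s.1.1 (+) odd s.1.2 then odd s.1.2 else s.2).

Lemma leq_stepP (u : seq bool) a b r : a < 2 ^ size u -> b < 2 ^ size u ->
  (foldl (fun s _ => leq_step s) (a, b, r) u).2 = if a == b then r else a < b.
Proof.
elim: u a b r => [|x u IH] a b r /=.
  by rewrite expn0 !ltnS !leqn0 => /eqP-> /eqP->.
rewrite expnS => Ha Hb.
have half_lt k : k < 2 * 2 ^ size u -> k./2 < 2 ^ size u.
  by rewrite -{1}(odd_double_half k); lia.
rewrite [LHS]IH ?half_lt //=.
move: (odd_double_half a) (odd_double_half b).
move: (odd a) (odd b) a./2 b./2 => x1 x2 p q <- <-.
by case: (ltngtP p q) => pq; case: eqP => e; case: x1 x2 e => -[] /=; lia.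
Qed.

Section Leq.
Context {X : Type} {eX : encoding X}.

Lemma esize_half k : esize k./2 <= esize k.
Proof.
rewrite !esize_natE [in leqRHS]binaryE; case: k => // k.
by rewrite esize_cons; lia.
Qed.

Lemma polytime_leq (a b : X -> nat) : polytime a -> polytime b ->
  polytime (fun x => a x <= b x).
Proof.
move=> pa pb.
apply: (polytime_recode (g := fun x => (foldl (fun s (_ : bool) => leq_step s) (a x, b x, true)
  (binary (a x) ++ binary (b x))).2)) => [x|].
  rewrite leq_stepP; first by rewrite leq_eqVlt; case: eqP.
    by rewrite size_cat expnD; apply: leq_trans (ltn_nbits _) _; rewrite leq_pmulr ?expn_gt0.
  by rewrite size_cat expnD; apply: leq_trans (ltn_nbits _) _; rewrite leq_pmull ?expn_gt0.
apply: polytime_snd.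
apply: (polytime_foldl_additive (B := fun _ => 8) (h := fun _ s (_ : bool) => leq_step s)).
- by polyfun_tac.
- move=> _ [[m n] c] _; rewrite /leq_step /= !esize_pair.
  have := esize_half m; have := esize_half n.
  have eb (y : bool) : 0 < esize y <= 3 by case: y.
  move: (eb (if odd m (+) odd n then odd n else c)) (eb c); lia.
- by rewrite /leq_step; pt.
- by pt.
by pt.
Qed.

Lemma polytime_eqn (a b : X -> nat) : polytime a -> polytime b ->
  polytime (fun x => a x == b x).
Proof.
move=> pa pb; apply: (polytime_recode (g := fun x => (a x <= b x) && (b x <= a x))).
  by move=> x; rewrite eqn_leq.
by apply: polytime_andb; apply: polytime_leq.
Qed.

Lemma of_bits_cat u v n : of_bits (u ++ v) n = of_bits v (of_bits u n).
Proof. exact: foldl_cat. Qed.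

Lemma of_bits_rev_binary n : of_bits (rev (binary n)) 0 = n.
Proof.
elim/ltn_ind: n => n IH; rewrite binaryE; case: eqP => [->//|/eqP n0].
rewrite rev_cons -cats1 of_bits_cat IH; first exact: cons_bit_half.
by move: (odd_double_half n) n0; lia.
Qed.

Lemma of_bits_lt u : of_bits u 0 < 2 ^ size u.
Proof.
elim/last_ind: u => // u b IH.
by rewrite -cats1 of_bits_cat size_cat expnD /= /cons_bit; case: b; lia.
Qed.

(** Horner's scheme along the digits of [a x], leading digit first. The closed form [hE] shows that
    each accumulator is a number given by a prefix of these digits times [b x], which bounds its
    digits. *)
Lemma polytime_muln (a b : X -> nat) : polytime a -> polytime b ->
  polytime (fun x => a x * b x).
Proof.
move=> pa pb.
pose h x acc (c : bool) := cons_bit false acc + (if c then b x else 0).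
have hE x u acc : foldl (h x) acc u = acc * 2 ^ size u + of_bits u 0 * b x.
  elim/last_ind: u => [|u c IH]; first by rewrite muln1 mul0n addn0.
  rewrite foldl_rcons IH /h /cons_bit size_rcons expnS -cats1 of_bits_cat /= /cons_bit.
  by case: c; lia.
apply: (polytime_recode (g := fun x => foldl (h x) 0 (rev (binary (a x))))) => [x|].
  by rewrite hE mul0n of_bits_rev_binary.
have [Q [HQ Qs]] := polytime_size pb; have [R [HR Rs]] := polytime_size pa.
apply: (polytime_foldl (Q := fun n => 4 * (R n + Q n) + 1)) => //.
- by polyfun_tac.
- move=> x l1 l2 El; rewrite hE mul0n; apply: leq_trans.
    apply: (@esize_nat_pow _ (size l1 + nbits (b x))).
    by rewrite expnD ltn_mul ?of_bits_lt ?ltn_nbits.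
  rewrite leq_add2r leq_mul2l /=.
  have := Rs x; have := Qs x; have /andP[ha _] := esize_nat (a x); have /andP[hb _] := esize_nat (b x).
  have : size l1 <= nbits (a x) by rewrite /nbits -(size_rev (binary (a x))) El size_cat leq_addr.
  lia.
- rewrite /h; pt.
  by apply: (polytime_comp pb); pt.
all: by pt.
Qed.

End Leq.

Ltac pt_ext ::= first
 [ simple apply polytime_andb | simple apply polytime_negb | simple apply polytime_xor
 | simple apply polytime_binary | simple apply polytime_odd | simple apply polytime_half
 | simple apply polytime_eq0 | simple apply polytime_cons_bit
 | simple apply polytime_cat | simple apply polytime_rev
 | simple apply polytime_of_bits | simple apply polytime_addn
 | simple apply polytime_leq | simple apply polytime_eqn | simple apply polytime_muln ].

Definition number_fold {A} (l : seq A) : nat * seq (nat * A) :=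
  foldl (fun s a => (s.1 + 1, (s.1, a) :: s.2)) (0, [::]) l.

Lemma number_foldE A (l : seq A) :
  number_fold l = (size l, rev (zip (iota 0 (size l)) l)).
Proof.
elim/last_ind: l => // l a IH; rewrite /number_fold foldl_rcons -/(number_fold l) IH /=.
rewrite size_rcons -[(size l).+1]addn1 iotaD add0n /= -[in RHS]cats1 zip_cat ?size_iota //.
by rewrite rev_cat.
Qed.

Section Number.
Context {X A : Type} {eX : encoding X} {eA : encoding A}.

Lemma polytime_number_fold (l : X -> seq A) : polytime l ->
  polytime (fun x => number_fold (l x)).
Proof.
move=> pl; have [L [HL Ls]] := polytime_size pl.
(* The first summand bounds the counter; each of at most [L n] entries is enlarged by an index no
   bigger than that and by the nodes attached to it. *)
apply: (polytime_foldl (Q := fun n => (4 * L n + 1) + (L n + L n * (4 * L n + 3)) + 2)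
  (h := fun _ s a => (s.1 + 1, (s.1, a) :: s.2))) => //.
- by polyfun_tac.
- move=> x l1 l2 El; rewrite -[foldl _ _ _]/(number_fold l1) number_foldE esize_pair.
  have le_l1 : esize l1 <= L (esize x).
    apply: leq_trans (Ls x); rewrite El.
    have E : (esize (l1 ++ l2)).+1 = esize l1 + esize l2 by exact: esize_cat.
    have l2_gt0 : 0 < esize l2 by exact: esize_gt0.
    by lia.
  have le_s : size l1 <= L (esize x) by apply: leq_trans le_l1; apply: ltnW (size_le_esize _).
  have esn n : n <= L (esize x) -> esize n <= 4 * L (esize x) + 1.
    move=> le_n; apply: leq_trans (esize_nat_pow (ltn_expl _ _)) _ => //.
    by rewrite leq_add2r leq_mul2l le_n.
  have le_out : forall u : seq A, size u <= L (esize x) ->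
      esize (rev (zip (iota 0 (size u)) u)) <= esize u + size u * (4 * L (esize x) + 3).
    elim/last_ind => // u a IH; rewrite size_rcons => le_u.
    rewrite -[(size u).+1]addn1 iotaD add0n -[in leqLHS]cats1 zip_cat ?size_iota // rev_cat /= esize_cons esize_pair.
    have {}IH := IH (ltnW le_u); have := esn _ (ltnW le_u).
    have E : esize (rcons u a) = esize u + esize a + 1.
      rewrite -cats1.
      have : (esize (u ++ [:: a])).+1 = esize u + esize [:: a] by exact: esize_cat.
      by rewrite esize_cons esize_nil; lia.
    by rewrite E; lia.
  have := esn _ le_s; have := le_out _ le_s.
  have : size l1 * (4 * L (esize x) + 3) <= L (esize x) * (4 * L (esize x) + 3).
    by rewrite leq_mul2r le_s orbT.
  lia.
all: by pt.
Qed.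

Lemma polytime_size_seq (l : X -> seq A) : polytime l -> polytime (fun x => size (l x)).
Proof.
move=> pl; apply: (polytime_recode (g := fun x => (number_fold (l x)).1)).
  by move=> x; rewrite number_foldE.
by apply: polytime_fst; apply: polytime_number_fold.
Qed.

(** For [take] and [drop] with a binary argument: selecting by position costs time in the length of
    the list, however large the number compared with is. *)
Lemma polytime_select (p : X -> nat -> bool) (l : X -> seq A) :
  polytime (fun y : X * nat => p y.1 y.2) -> polytime l ->
  polytime (fun x => [seq z.2 | z <- zip (iota 0 (size (l x))) (l x) & p x z.1]).
Proof.
move=> pp pl.
apply: (polytime_recode (g := fun x =>
   [seq z.2 | z <- rev (number_fold (l x)).2 & p x z.1])).
  by move=> x; rewrite number_foldE revK.
apply: (polytime_map (f := fun _ z => z.2)); first by pt.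
apply: (polytime_filter (p := fun x z => p x z.1)).
  by apply: (polytime_comp (g := fun y : X * (nat * A) => (y.1, y.2.1)) pp); pt.
by apply: polytime_rev; apply: polytime_snd; apply: polytime_number_fold.
Qed.

Lemma takeE n (l : seq A) : take n l = [seq z.2 | z <- zip (iota 0 (size l)) l & z.1 < n].
Proof.
have nil k u : [seq z <- zip (iota (n + k) (size u)) u | z.1 < n] = [::] :> seq (nat * A).
  by elim: u k => //= a u IH k; rewrite ltnNge leq_addr -addnS IH.
have gen m k : k + m = n ->
    take m l = [seq z.2 | z <- zip (iota k (size l)) l & z.1 < n].
  elim: l m k => // a l IH [|m] k Ek /=.
    have Ek' : k = n by lia.
    by rewrite Ek' ltnn -[n.+1]addn1 nil.
  have -> : k < n by lia.
  by rewrite /= -(IH m) ?addSnnS.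
exact: gen.
Qed.

Lemma dropE n (l : seq A) : drop n l = [seq z.2 | z <- zip (iota 0 (size l)) l & n <= z.1].
Proof.
have full k u : [seq z.2 | z <- zip (iota (n + k) (size u)) u & n <= z.1] = u :> seq A.
  by elim: u k => //= a u IH k; rewrite leq_addr -addnS /= IH.
have gen m k : k + m = n ->
    drop m l = [seq z.2 | z <- zip (iota k (size l)) l & n <= z.1].
  elim: l m k => // a l IH [|m] k Ek.
    have -> : k = n + 0 by lia.
    by rewrite full.
  rewrite /= ifF; last by lia.
  by rewrite -(IH m) ?addSnnS.
exact: gen.
Qed.

Lemma polytime_take (n : X -> nat) (l : X -> seq A) : polytime n -> polytime l ->
  polytime (fun x => take (n x) (l x)).
Proof.
move=> pn pl; apply: (polytime_recode (g := fun x =>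
   [seq z.2 | z <- zip (iota 0 (size (l x))) (l x) & z.1 < n x])).
  by move=> x; rewrite takeE.
apply: (polytime_select (p := fun x i => i < n x)) => //.
apply: (polytime_recode (g := fun y => y.2 + 1 <= n y.1)); first by move=> x; rewrite addn1.
by pt; apply: (polytime_comp pn); pt.
Qed.

Lemma polytime_drop (n : X -> nat) (l : X -> seq A) : polytime n -> polytime l ->
  polytime (fun x => drop (n x) (l x)).
Proof.
move=> pn pl; apply: (polytime_recode (g := fun x =>
   [seq z.2 | z <- zip (iota 0 (size (l x))) (l x) & n x <= z.1])).
  by move=> x; rewrite dropE.
apply: (polytime_select (p := fun x i => n x <= i)) => //.
by pt; apply: (polytime_comp pn); pt.
Qed.

End Number.

(** * The decision procedure *)

Notation frac := (nat * nat)%type.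

(** No reduction to lowest terms: denominators simply multiply, so no division or gcd is
    required. *)
Definition addq (p q : frac) : frac := (p.1 * q.2 + q.1 * p.2, p.2 * q.2).
Definition sumq (l : seq frac) : frac := foldl addq (0, 1) l.
Definition leqq (p q : frac) : bool := p.1 * q.2 <= q.1 * p.2.
Definition insertq (p : frac) (l : seq frac) : seq frac :=
  [seq q <- l | leqq p q] ++ p :: [seq q <- l | ~~ leqq p q].
Definition sortq (l : seq frac) : seq frac := foldl (fun s p => insertq p s) [::] l.

Definition few_transfers (poor rich : seq frac) (k : nat) : bool :=
  leqq (sumq rich) (sumq (poor ++ take k (sortq rich) ++ take (k + 1) (sortq rich))).

Definition owned (i : nat) (u : seq frac) (own : seq nat) : seq frac :=
  [seq z.1 | z <- zip u own & z.2 == i].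

Definition decide_bundles (b0 b1 : seq frac) (k : nat) : bool :=
  if leqq (sumq b0) (sumq b1) then few_transfers b0 b1 k else few_transfers b1 b0 k.

(** Exactly what makes the lists describe an instance: nonzero denominators, owners 0 or 1, and
    equal values for both agents although their fractions may be written differently. Nonnegativity
    is built into natural numerators. *)
Definition valid_data (u0 u1 : seq frac) (own : seq nat) : bool :=
  all (fun q => ~~ (q.2 == 0)) u0 && (all (fun q => ~~ (q.2 == 0)) u1 &&
  (all (fun o => o + 1 <= 2) own &&
   all (fun z => z.1.1 * z.2.2 == z.2.1 * z.1.2) (zip u0 u1))).

Definition decide_data (u0 u1 : seq frac) (own : seq nat) (k : nat) : bool :=
  valid_data u0 u1 own && decide_bundles (owned 0 u0 own) (owned 1 u0 own) k.

Definition pair_step (s : seq nat * seq frac) (a : nat) : seq nat * seq frac :=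
  if nilp s.1 then ([:: a], s.2) else ([::], (head 0 s.1, a) :: s.2).

Definition pair_up (l : seq nat) : seq frac := rev (foldl pair_step ([::], [::]) l).2.

(* [2 * m] integers for the fractions of each agent, [m] owners, and the bound. *)
Definition decide_rest (m : nat) (r : seq nat) : bool :=
  ~~ (m == 0) && ((size r == 5 * m + 1) &&
  decide_data (pair_up (take (2 * m) r)) (pair_up (take (2 * m) (drop (2 * m) r)))
    (take m (drop (4 * m) r)) (head 0 (drop (5 * m) r))).

Definition decide_nats (l : seq nat) : bool :=
  (head 0 l == 2) && decide_rest (head 0 (behead l)) (behead (behead l)).

Definition symbol_bits (a : option bool) : bool * bool :=
  if a is Some b then (true, b) else (false, false).

(* The number being read is stored most significant bit first; [binary] forbids
   that this bit is 0. *)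
Definition decode_step (s : bool * (seq bool * seq nat)) (a : bool * bool) :
    bool * (seq bool * seq nat) :=
  if a.1 then (s.1, (a.2 :: s.2.1, s.2.2))
  else (s.1 && head true s.2.1, ([::], of_bits s.2.1 0 :: s.2.2)).

Definition decode_fold (w : seq (bool * bool)) : bool * (seq bool * seq nat) :=
  foldl decode_step (true, ([::], [::])) w.

(** No digits may be pending at the end, because every number, the last one included, has a
    separator. *)
Definition decide_word (w : seq (bool * bool)) : bool :=
  ((decode_fold w).1 && nilp (decode_fold w).2.1) &&
  decide_nats (rev (decode_fold w).2.2).

Section Fractions.
Context {X : Type} {eX : encoding X}.
Implicit Types (p q : X -> frac) (l : X -> seq frac) (k : X -> nat).

Lemma polytime_addq p q : polytime p -> polytime q -> polytime (fun x => addq (p x) (q x)).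
Proof. by move=> pp pq; rewrite /addq; pt. Qed.

Lemma polytime_leqq p q : polytime p -> polytime q -> polytime (fun x => leqq (p x) (q x)).
Proof. by move=> pp pq; rewrite /leqq; pt. Qed.

End Fractions.

(** Numerator plus denominator is submultiplicative: [(a d + c b) + b d <= (a + b) (c + d)]. On the
    scale of bit lengths this is additive, like the size of the list. *)
Lemma sumq_lt (l : seq frac) : (sumq l).1 + (sumq l).2 < 2 ^ esize l.
Proof.
elim/last_ind: l => // l q IH; rewrite /sumq foldl_rcons -/(sumq l) /addq /=.
have -> : esize (rcons l q) = esize l + (esize q + 1).
  rewrite -cats1; have : (esize (l ++ [:: q])).+1 = esize l + esize [:: q] by exact: esize_cat.
  by rewrite esize_cons esize_nil; lia.
have lt_q : q.1 + q.2 < 2 ^ (esize q + 1).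
  case: q => a b /=; rewrite esize_pair.
  have /andP[Ha _] := esize_nat a; have /andP[Hb _] := esize_nat b.
  have la : a < 2 ^ esize a by apply: leq_trans (ltn_nbits a) _; rewrite leq_exp2l // ltnW.
  have lb : b < 2 ^ esize b by apply: leq_trans (ltn_nbits b) _; rewrite leq_exp2l // ltnW.
  have le_a : 2 ^ esize a <= 2 ^ (esize a + esize b) by rewrite leq_exp2l // leq_addr.
  have le_b : 2 ^ esize b <= 2 ^ (esize a + esize b) by rewrite leq_exp2l // leq_addl.
  by rewrite addn1 !expnS; lia.
rewrite expnD; apply: leq_ltn_trans (ltn_mul IH lt_q).
by case: (sumq l) q {IH lt_q} => a b [c d] /=; nia.
Qed.

Section Bundles.
Context {X : Type} {eX : encoding X}.
Implicit Types (p q : X -> frac) (l : X -> seq frac) (k : X -> nat).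

Lemma polytime_sumq l : polytime l -> polytime (fun x => sumq (l x)).
Proof.
move=> pl; have [L [HL Ls]] := polytime_size pl.
apply: (polytime_foldl (Q := fun n => (4 * L n + 1) + (4 * L n + 1) + 1)
  (h := fun _ s a => addq s a)) => //.
- by polyfun_tac.
- move=> x l1 l2 El; rewrite -[foldl _ _ _]/(sumq l1).
  have le_l1 : esize l1 <= L (esize x).
    apply: leq_trans (Ls x); rewrite El.
    have E : (esize (l1 ++ l2)).+1 = esize l1 + esize l2 by exact: esize_cat.
    have l2_gt0 : 0 < esize l2 by exact: esize_gt0.
    by lia.
  have lt_s : (sumq l1).1 + (sumq l1).2 < 2 ^ L (esize x).
    by apply: leq_trans (sumq_lt l1) _; rewrite leq_exp2l.
  case: (sumq l1) lt_s => a b /= lt_s; rewrite esize_pair.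
  have := esize_nat_pow (leq_ltn_trans (leq_addr b a) lt_s).
  have := esize_nat_pow (leq_ltn_trans (leq_addl a b) lt_s).
  by lia.
- by apply: polytime_addq; pt.
by pt.
Qed.

Lemma polytime_insertq p l : polytime p -> polytime l ->
  polytime (fun x => insertq (p x) (l x)).
Proof.
move=> pp pl; rewrite /insertq.
have pq : polytime (fun y : X * frac => leqq (p y.1) y.2).
  by apply: polytime_leqq; [apply: (polytime_comp pp)|]; pt.
apply: polytime_cat; first exact: (polytime_filter (p := fun x r => leqq (p x) r)).
apply: polytime_cons => //; apply: (polytime_filter (p := fun x r => ~~ leqq (p x) r)) => //.
exact: polytime_negb.
Qed.

End Bundles.

Section Decision.
Context {X : Type} {eX : encoding X}.
Implicit Types (l : X -> seq frac) (own : X -> seq nat) (k : X -> nat).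

Lemma polytime_sortq l : polytime l -> polytime (fun x => sortq (l x)).
Proof.
move=> pl; apply: (polytime_foldl_additive (B := fun n => n + 1) (h := fun _ s p => insertq p s)) => //.
- by polyfun_tac.
- move=> x s a; rewrite /insertq.
  have E : (esize ([seq q <- s | leqq a q] ++ a :: [seq q <- s | ~~ leqq a q])).+1 =
     esize [seq q <- s | leqq a q] + esize (a :: [seq q <- s | ~~ leqq a q]).
    exact: esize_cat.
  have : esize [seq q <- s | leqq a q] + esize [seq q <- s | ~~ leqq a q] = esize s + 1.
    elim: s {E} => //= b s IH; case: ifP => _ /=; rewrite !esize_cons; lia.
  by move: E; rewrite esize_cons; lia.
- by apply: polytime_insertq; pt.
by pt.
Qed.

Lemma polytime_few_transfers l l' k : polytime l -> polytime l' -> polytime k ->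
  polytime (fun x => few_transfers (l x) (l' x) (k x)).
Proof.
move=> pl pl' pk; have ps := polytime_sortq pl'.
apply: polytime_leqq; apply: polytime_sumq => //.
by apply: polytime_cat => //; apply: polytime_cat; apply: polytime_take => //; pt.
Qed.

Lemma polytime_decide_bundles l l' k : polytime l -> polytime l' -> polytime k ->
  polytime (fun x => decide_bundles (l x) (l' x) (k x)).
Proof.
move=> pl pl' pk; apply: polytime_if; last exact: polytime_few_transfers.
  by apply: polytime_leqq; apply: polytime_sumq.
exact: polytime_few_transfers.
Qed.

Lemma polytime_owned i l own : polytime l -> polytime own ->
  polytime (fun x => owned i (l x) (own x)).
Proof.
move=> pl po; apply: (polytime_map (f := fun _ z => z.1)); first by pt.
apply: (polytime_filter (p := fun _ z => z.2 == i)); first by pt.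
exact: (polytime_zip 0).
Qed.

Lemma polytime_decide_data l l' own k : polytime l -> polytime l' -> polytime own ->
  polytime k -> polytime (fun x => decide_data (l x) (l' x) (own x) (k x)).
Proof.
move=> pl pl' po pk; apply: polytime_andb.
  apply: polytime_andb; first by apply: (polytime_all (p := fun _ q => ~~ (q.2 == 0))); pt.
  apply: polytime_andb; first by apply: (polytime_all (p := fun _ q => ~~ (q.2 == 0))); pt.
  apply: polytime_andb; first by apply: (polytime_all (p := fun _ o => o + 1 <= 2)); pt.
  apply: (polytime_all (p := fun _ z => z.1.1 * z.2.2 == z.2.1 * z.1.2)); first by pt.
  exact: (polytime_zip (0, 0)).
by apply: polytime_decide_bundles => //; apply: polytime_owned.
Qed.

Lemma polytime_pair_up own : polytime own -> polytime (fun x => pair_up (own x)).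
Proof.
move=> po; apply: polytime_rev; apply: polytime_snd.
apply: (polytime_foldl_additive (B := fun n => n + 3) (h := fun _ s a => pair_step s a)) => //.
- by polyfun_tac.
- move=> x [[|b v] s] a; rewrite /pair_step /= !esize_pair !esize_cons ?esize_nil ?esize_pair; lia.
- by rewrite /pair_step; pt.
by pt.
Qed.

Lemma polytime_decide_rest k own : polytime k -> polytime own ->
  polytime (fun x => decide_rest (k x) (own x)).
Proof.
move=> pk po; apply: polytime_andb; first by pt.
apply: polytime_andb; first by apply: polytime_eqn; [exact: polytime_size_seq|pt].
have pm c : polytime (fun x => c * k x) by pt.
apply: polytime_decide_data.
- by apply: polytime_pair_up; apply: polytime_take.
- by apply: polytime_pair_up; apply: polytime_take => //; apply: polytime_drop.
- by apply: polytime_take => //; apply: polytime_drop.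
by apply: polytime_head; apply: polytime_drop.
Qed.

Lemma polytime_decide_nats own : polytime own -> polytime (fun x => decide_nats (own x)).
Proof.
by move=> po; apply: polytime_andb; [pt|apply: polytime_decide_rest; pt].
Qed.

End Decision.

Lemma polytime_decide_word : polytime decide_word.
Proof.
have pd : polytime decode_fold.
  apply: (polytime_foldl_additive (B := fun n => n + 8) (h := fun _ s a => decode_step s a)
    (s0 := fun _ => (true, ([::], [::]))) (l := fun w => w)) => //.
  - by polyfun_tac.
  - move=> x [ok [cur out]] [f b]; rewrite /decode_step; case: f => /=.
      by rewrite !esize_pair !esize_cons; lia.
    rewrite !esize_pair !esize_cons esize_nil.
    have lt_b := esize_of_bits cur 0.
    have eb (y : bool) : 0 < esize y <= 3 by case: y.
    have e0 : esize 0 = 1 by rewrite esize_natE binaryE.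
    by have := eb (ok && head true cur); have := eb ok; lia.
  - by rewrite /decode_step; pt.
  - by pt.
  by pt.
by apply: polytime_andb; [pt|apply: polytime_decide_nats; pt].
Qed.

(** * From polynomial time on encoded data to P *)

Definition symbol_code (a : option bool) : seq symb := one :: code (enc (symbol_bits a)).

Definition push_list (u : seq symb) (p : prog) : prog :=
  foldr (fun a q => Push RtT a ;; q) p u.

Lemma run_push_list u p i d r s c n s' :
  run_le p (Store i d (catrev u r) s c) n s' ->
  run_le (push_list u p) (Store i d r s c) (2 * size u + n) s'.
Proof.
elim: u r => //= a u IH r /IH R; rewrite mulnS -addnA.
by apply: run_le_seq (run_le_push _ _ _) _; exact: R.
Qed.

Definition read_symbol : prog :=
  If InT (fun x => x == Some (inl None)) (push_list (symbol_code None) (Pop InT))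
   (If InT (fun x => x == Some (inl (Some true)))
      (push_list (symbol_code (Some true)) (Pop InT))
      (push_list (symbol_code (Some false)) (Pop InT))).

Lemma run_read_symbol a i d r s c :
  run_le read_symbol (Store (inl a :: i) d r s c) 20
    (Store i d (catrev (symbol_code a) r) s c).
Proof.
apply: (@run_le_weaken _ _ (2 * size (symbol_code a) + 1).+2); first by case: a => // -[].
have R : run_le (push_list (symbol_code a) (Pop InT)) (Store (inl a :: i) d r s c)
    (2 * size (symbol_code a) + 1) (Store i d (catrev (symbol_code a) r) s c).
  by apply: run_push_list; exact: run_le_pop.
case: a R => [[]|] R.
- by apply: run_le_if_false => //; apply: run_le_if_true.
- by apply: run_le_if_false => //; apply: run_le_if_false.
by apply: run_le_weaken (leqnSn _) _; apply: run_le_if_true.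
Qed.

(** Reading the input from left to right leaves on [RtT] the reversed code of the list above a mark,
    which is the [saved] form that [unload] expects. *)
Definition read_input : prog :=
  Push RtT mark ;; While InT isSome read_symbol ;; Push RtT zero ;; unload RtT.

Lemma code_input w : code (enc [seq symbol_bits a | a <- w]) =
  flatten [seq symbol_code a | a <- w] ++ [:: zero].
Proof. by elim: w => // a w IH; rewrite map_cons code_cons IH /= catA. Qed.

(** A pair of booleans takes at most seven symbols and its list node one more. *)
Lemma esize_input w : esize [seq symbol_bits a | a <- w] <= 8 * size w + 1.
Proof.
rewrite /esize -size_code code_input size_cat leq_add2r.
elim: w => // a w IH.
rewrite -[flatten _]/(symbol_code a ++ flatten [seq symbol_code b | b <- w]).
by rewrite size_cat mulnS leq_add //; case: a => // -[].
Qed.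

Lemma run_read_input :
  exists2 P, polyfun P & forall w, run_le read_input
    (Store [seq inl x | x <- w] [::] [::] [::] [::]) (P (size w))
    (Store [::] (code (enc [seq symbol_bits a | a <- w])) [::] [::] [::]).
Proof.
exists (fun n => 2 + ((21 * n + 1) + (2 + (2 + 5 * (8 * n + 1))))); first by polyfun_tac.
move=> w; apply: run_le_seq (run_le_push _ _ _) _.
have loopP u r : run_le (While InT isSome read_symbol)
    (Store [seq inl x | x <- u] [::] r [::] [::]) (21 * size u + 1)
    (Store [::] [::] (catrev (flatten [seq symbol_code a | a <- u]) r) [::] [::]).
  elim: u r => [|a u IH] r; first exact: run_le_while_stop.
  apply: (@run_le_weaken _ _ (20 + (21 * size u + 1)).+1); first by rewrite /= mulnS; lia.
  apply: run_le_while_step; [by []|exact: run_read_symbol|].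
  rewrite -[flatten _]/(symbol_code a ++ flatten [seq symbol_code b | b <- u]).
  have -> v : catrev (symbol_code a ++ v) r = catrev v (catrev (symbol_code a) r).
    by rewrite !catrevE rev_cat -catA.
  exact: IH.
apply: run_le_seq; first exact: loopP.
apply: run_le_seq (run_le_push _ _ _) _.
have sizeE := esize_input w; have codeE := code_input w.
rewrite /esize in sizeE; set t := enc _ in sizeE codeE *.
have := run_unloadR t [::] [::] [::] [::] [::].
rewrite /saved {1}codeE rev_cat cats0 catrevE => R.
by apply: run_le_weaken R; move: sizeE; lia.
Qed.

Lemma in_P_polytime (f : seq (bool * bool) -> bool) (L : seq (option bool) -> Prop) :
  polytime f -> (forall w, f [seq symbol_bits a | a <- w] <-> L w) -> in_P L.
Proof.
move=> [p [P [HP Hp]]] HL; have [Q HQ HR] := run_read_input.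
have HT : polyfun (fun n => Q n + P (8 * n + 1) + 1).
  by polyfun_tac; apply: (polyfun_comp HP); polyfun_tac.
have [q Eq] := polyfun_poly HT.
exists (compile (read_input ;; p)), q => w.
have [|t [b [le_t v_t Hb]]] := decides_compile
  (p := read_input ;; p) (L := L) (time := fun n => Q n + P (8 * n + 1)) _ w.
  move=> {}w.
  have [t le_t R] : run_le (read_input ;; p) (Store [seq inl x | x <- w] [::] [::] [::] [::])
     (Q (size w) + P (8 * size w + 1))
     (Store [::] (code (enc (f [seq symbol_bits a | a <- w])) ++ [::]) [::] [::] [::]).
    apply: run_le_seq (HR w) _.
    have := Hp [seq symbol_bits a | a <- w] [::] [::] [::] [::].
    rewrite !cats0; apply: run_le_weaken.
    by apply: polyfun_mono => //; apply: esize_input.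
  exists t, (Store [::] (code (enc (f [seq symbol_bits a | a <- w])) ++ [::]) [::] [::] [::]).
  by split=> //; rewrite -HL; case: (f _).
by exists t, b; split=> //; rewrite -Eq addn1.
Qed.

(** * The optimal number of transfers *)

Local Open Scope ring_scope.

Section TopSums.
Variables (T : eqType) (u : T -> rat).
Hypothesis u_ge0 : forall g, 0 <= u g.
Implicit Types (s : seq T) (k : nat).

Definition desc : rel T := fun g h => u h <= u g.

Definition top s k : rat := \sum_(g <- take k s) u g.

Lemma desc_trans : transitive desc.
Proof. by move=> g h e; rewrite /desc => H1 H2; apply: le_trans H1. Qed.

Lemma desc_total : total desc.
Proof. by move=> g h; rewrite /desc le_total. Qed.

Lemma sum_ge0 s (P : pred T) : 0 <= \sum_(g <- s | P g) u g.
Proof. exact: sumr_ge0. Qed.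

Lemma top_ge0 s k : 0 <= top s k.
Proof. exact: sum_ge0. Qed.

Lemma top_mono s j k : (j <= k)%N -> top s j <= top s k.
Proof.
move=> le_jk; rewrite /top -(subnKC le_jk) takeD big_cat /= lerDl.
exact: sum_ge0.
Qed.

Lemma topS s k (g0 : T) : (k < size s)%N -> top s k.+1 = top s k + u (nth g0 s k).
Proof.
by move=> lt_k; rewrite /top (take_nth g0 lt_k) -cats1 big_cat /= big_seq1.
Qed.

(* An unselected head [a] is exchanged for the last of the [k.+1] top entries
   of the tail. *)
Lemma sum_le_top s (P : pred T) k : sorted desc s -> (count P s <= k)%N ->
  \sum_(g <- s | P g) u g <= top s k.
Proof.
elim: s k => [|a s IH] k /=; first by rewrite big_nil top_ge0.
move=> Hs; have {}IH j := IH j (path_sorted Hs).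
rewrite big_cons; case: k => [|k].
  rewrite leqn0 addn_eq0 => /andP[/eqP Pa /eqP P0]; move: Pa; case: (P a) => // _.
  by apply: le_trans (IH 0%N _) _; rewrite ?P0 //= /top take0 big_nil.
rewrite /top /= big_cons -/(top s k); case: (P a) => /=.
  by rewrite add1n ltnS => /IH; rewrite lerD2l.
rewrite add0n => /IH/le_trans; apply.
case: (ltnP k (size s)) => [lt_k|le_k].
  rewrite (topS a lt_k) addrC lerD2r.
  have /allP := order_path_min desc_trans Hs; apply; exact: mem_nth.
by rewrite /top take_oversize 1?leqW // take_oversize // lerDr.
Qed.

End TopSums.

Section TwoAgents.
Variables (m : nat) (U : 'I_2 -> {set 'I_m} -> rat).
Variables (h2 : (1 < 2)%N) (h1 : (0 < m)%N) (Uge0 : forall i S, 0 <= U i S).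
Hypothesis Uadd : forall i S, U i S = \sum_(g in S) U i [set g].
(** The instance is assembled from its fields so that [agents I] computes to 2 and agents are
    elements of ['I_2]. *)
Let I : instance rat := @Instance _ 2 m U h2 h1 Uge0 Uadd.
Hypothesis Hid : identical_utilities I.

Let u g : rat := U ord0 [set g].

Definition wt (S : {set 'I_m}) : rat := \sum_(g in S) u g.

Lemma U_wt i S : U i S = wt S.
Proof. by rewrite Uadd; apply: eq_bigr => g _; apply: (Hid i ord0 [set g]). Qed.

Lemma u_ge0 g : 0 <= u g.
Proof. exact: Uge0. Qed.

Lemma wt_ge0 S : 0 <= wt S.
Proof. by apply: sumr_ge0 => g _; apply: u_ge0. Qed.

Lemma wtS (S S' : {set 'I_m}) : S \subset S' -> wt S <= wt S'.
Proof.
move=> sub; rewrite /wt [leRHS](big_setID S) /= (setIidPr sub) lerDl.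
exact: wt_ge0.
Qed.

Lemma wtD1 (S : {set 'I_m}) g : g \in S -> wt S = u g + wt (S :\ g).
Proof. exact: big_setD1. Qed.

Lemma wtID (S S' : {set 'I_m}) : wt S = wt (S :&: S') + wt (S :\: S').
Proof. exact: big_setID. Qed.

Lemma wt_set0 : wt set0 = 0.
Proof. exact: big_set0. Qed.

Section Allocations.
Variables p r : 'I_2.
Hypothesis ne_pr : p != r.

Lemma agentE (i : 'I_2) : (i == r) = (i != p).
Proof. by case: i p r ne_pr => [[|[|]]] // Hi [[|[|]]] // Hp [[|[|]]]. Qed.

Lemma bundle_pE (A : allocation I) : bundle A p = ~: bundle A r.
Proof. by apply/setP => g; rewrite !inE agentE negbK. Qed.

Lemma wt_total (A : allocation I) : wt (bundle A p) + wt (bundle A r) = wt [set: 'I_m].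
Proof.
by rewrite [RHS](wtID _ (bundle A p)) setTI setTD bundle_pE setCK.
Qed.

(** A transfer changes one owner, so the set of goods whose first and last owners differ gains at
    most one element per step. *)
Lemma path_card (A : allocation I) s : path (@transfer _ I) A s ->
  (#|[set g | A g != last A s g]| <= size s)%N.
Proof.
elim: s A => [|B s IH] A /=.
  by move=> _; rewrite leqn0 cards_eq0; apply/eqP/setP => g; rewrite !inE eqxx.
case/andP=> /existsP[g /andP[_ /forallP Hg]] /IH IHB.
apply: leq_trans (_ : (#|g |: [set h | B h != last B s h]| <= _)%N).
  apply: subset_leq_card; apply/subsetP => h; rewrite !inE.
  by move=> ne; case: eqP => //= /eqP hg; have := Hg h; rewrite hg => /eqP <-.
by rewrite cardsU1; case: (_ \notin _); rewrite ?add1n ?add0n ?ltnS // leqW.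
Qed.

Variable A : allocation I.

Definition sorted_bundle : seq 'I_m := sort (desc u) (enum (bundle A r)).

Notation s := sorted_bundle.
Notation topk := (top u s).

(** In the form [u(r) - s_(k+1) <= u(p) + s_k] this is the EF1 condition of [p] after the top [k]
    goods of [r] were handed over, the next good being the one left out. *)
Definition enough k := wt (bundle A r) <= wt (bundle A p) + topk k + topk k.+1.

Lemma sorted_s : sorted (desc u) s.
Proof. by apply: sort_sorted; apply: desc_total. Qed.

Lemma uniq_s : uniq s.
Proof. by rewrite sort_uniq enum_uniq. Qed.

Lemma mem_s g : (g \in s) = (A g == r).
Proof. by rewrite mem_sort mem_enum inE. Qed.

Lemma wt_seq l : uniq l -> wt [set g in l] = \sum_(g <- l) u g.
Proof.
move=> Ul; rewrite /wt big_uniq //=; by apply: eq_bigl => g; rewrite inE.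
Qed.

Lemma top_full k : (size s <= k)%N -> topk k = wt (bundle A r).
Proof.
move=> le_k; rewrite /top take_oversize // -wt_seq ?uniq_s //.
by congr wt; apply/setP => g; rewrite !inE mem_s.
Qed.

Lemma wt_le_top (X : {set 'I_m}) k : X \subset bundle A r -> (#|X| <= k)%N ->
  wt X <= topk k.
Proof.
move=> /subsetP sub le_k.
have -> : wt X = \sum_(g <- s | g \in X) u g.
  rewrite -big_filter -wt_seq ?filter_uniq ?uniq_s //.
  congr wt; apply/setP => g; rewrite !inE mem_filter mem_s.
  by case: (boolP (g \in X)) => // /sub; rewrite inE.
apply: sum_le_top; [exact: u_ge0|exact: sorted_s|].
apply: leq_trans le_k; rewrite -size_filter cardE uniq_leq_size ?filter_uniq ?uniq_s //.
by move=> g; rewrite mem_filter mem_enum => /andP[].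
Qed.

Lemma enough_of_EF1_after T : EF1_after A T -> enough T.
Proof.
case=> l [sz_l pth EF].
set B := last A l in EF; have cD := path_card pth; rewrite -/B sz_l in cD.
(* The goods that left [r]; their weight is at most [s_T]. Goods that moved the other way only make
   matters worse for [p]. *)
set X := bundle A r :\: bundle B r.
have sX : X \subset bundle A r by apply: subsetDl.
have cX : (#|X| <= T)%N.
  apply: leq_trans cD; apply: subset_leq_card; apply/subsetP => g.
  by rewrite !inE => /andP[ne /eqP->]; rewrite eq_sym.
have wX := wt_le_top sX cX.
have mono : topk T <= topk T.+1 by apply: top_mono => //; apply: u_ge0.
have tA := wt_total A; have tB := wt_total B.
have dA := wtID (bundle A r) (bundle B r); rewrite -/X in dA.
have dB := wtID (bundle B r) (bundle A r); rewrite setIC in dB.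
have := wt_ge0 (bundle B r :\: bundle A r); have := wt_ge0 (bundle A p).
have t0 : 0 <= topk T by apply: top_ge0; apply: u_ge0.
rewrite /enough; case: (EF p r ne_pr) => [B0|[g gB]].
  (* An empty final bundle means that all of the rich bundle lies in [X]. *)
  by move: dA; rewrite B0 setI0 wt_set0; lra.
rewrite /= !U_wt => ef; have gD := wtD1 gB.
have ug := u_ge0 g.
case: (boolP (g \in bundle A r)) => gA.
  (* The removed good was in the rich bundle from the start: together with [X] it makes at most
     [T + 1] goods of that bundle. *)
  have gX : g \notin X by rewrite inE gB.
  have : wt (g |: X) <= topk T.+1.
    apply: wt_le_top; last by rewrite cardsU1 gX.
    by rewrite subUset sub1set gA.
  rewrite (@wtD1 (g |: X) g) ?setU11 // setU1K //; lra.
(* The removed good came from the other bundle, so what [r] kept of its own is already covered, and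
   twice [s_T] suffices. *)
have gBA : g \in bundle B r :\: bundle A r by rewrite inE gA.
have := wtD1 gBA; have := wt_ge0 ((bundle B r :\: bundle A r) :\ g); lra.
Qed.

Definition give (l : seq 'I_m) : allocation I :=
  [ffun h => if h \in l then p else A h].

End Allocations.

Lemma give_path (p : 'I_2) (A : allocation I) l : uniq l -> all (fun g => A g != p) l ->
  exists c, [/\ size c = size l, path (@transfer _ I) A c & last A c = give p A l].
Proof.
elim: l A => [|g l IH] A /=.
  by move=> _ _; exists [::]; split=> //=; apply/ffunP => h; rewrite ffunE.
case/andP=> gl Ul /andP[Ag All].
pose B : allocation I := [ffun h => if h == g then p else A h].
have [||c [sz pth la]] := IH B => //.
  apply/allP => h hl; rewrite ffunE; case: (h =P g) => [E|_]; last exact: (allP All h hl).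
  by rewrite -E hl in gl.
exists (B :: c); split=> /=; first by rewrite sz.
  rewrite pth andbT; apply/existsP; exists g; rewrite ffunE eqxx Ag /=.
  by apply/forallP => h; apply/implyP => /negPf ne; rewrite ffunE ne.
rewrite la; apply/ffunP => h; rewrite !ffunE inE; case: eqP => [->|_] //=.
by rewrite (negPf gl).
Qed.

(** * Optimality of handing over the most valuable goods *)

Section Greedy.
Variables p r : 'I_2.
Hypothesis ne_pr : p != r.
Variable A : allocation I.
Hypothesis le_pr : wt (bundle A p) <= wt (bundle A r).
Notation s := (sorted_bundle r A).
Notation topk := (top u s).

Lemma EF1_after_enough t : enough p r A t -> (forall j, enough p r A j -> (t <= j)%N) ->
  EF1_after A t.
Proof.
move=> Ht tmin.
(* Handing over the whole bundle satisfies the inequality, so the least solution is no larger than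
   the bundle. *)
have le_t : (t <= size s)%N.
  apply: tmin; rewrite /enough !top_full //.
  have := wt_ge0 (bundle A p); have := wt_ge0 (bundle A r); lra.
set l := take t s; have sz_l : size l = t by rewrite size_takel.
have Ul : uniq l by rewrite take_uniq // uniq_s.
have lr g : g \in l -> A g = r by move=> /mem_take; rewrite mem_s => /eqP.
have [|c [sz pth la]] := @give_path p A l Ul.
  by apply/allP => g /lr->; rewrite eq_sym.
exists c; split=> //; first by rewrite sz.
rewrite la; set B := give p A l.
have Br : bundle B r = bundle A r :\: [set g in l].
  by apply/setP => g; rewrite !inE ffunE; case: ifP => //= _; rewrite (negPf ne_pr).
have wl : wt [set g in l] = topk t by rewrite wt_seq.
have wBr : wt (bundle B r) = wt (bundle A r) - topk t.
  rewrite Br -wl (wtID (bundle A r) [set g in l]).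
  have -> : bundle A r :&: [set g in l] = [set g in l].
    by apply/setIidPr/subsetP => g; rewrite !inE => /lr->.
  by rewrite addrC addKr.
have tA := wt_total ne_pr A; have tB := wt_total ne_pr B.
have EFpr : EF1_towards B p r.
  case: (ltnP t (size s)) => lt_t; last first.
    (* Everything has been handed over, and the rich bundle is empty. *)
    left; rewrite Br; apply/setP => g; rewrite !inE /l take_oversize // mem_s.
    by case: (A g == r).
  right; have g0 : 'I_m by case: (s) lt_t.
  exists (nth g0 s t).
    rewrite Br inE [_ \in bundle A r]inE -mem_s mem_nth // andbT inE.
    have := uniq_s r A; rewrite -[in uniq _](cat_take_drop t s) cat_uniq => /and3P[_ /hasPn H _].
    by apply: H; rewrite (drop_nth g0) // inE eqxx.
  have gB : nth g0 s t \in bundle B r.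
    rewrite Br inE [_ \in bundle A r]inE -mem_s mem_nth // andbT inE.
    have := uniq_s r A; rewrite -[in uniq _](cat_take_drop t s) cat_uniq => /and3P[_ /hasPn H _].
    by apply: H; rewrite (drop_nth g0) // inE eqxx.
  suff : wt (bundle B r :\ nth g0 s t) <= wt (bundle B p) by rewrite -!(U_wt p).
  have := wtD1 gB.
  have := topS u g0 lt_t; move: Ht; rewrite /enough; lra.
have EFrp : EF1_towards B r p.
  (* Without transfers the rich agent is content because [le_pr] holds; otherwise the good left out
     is the last one handed over. *)
  case: t Ht tmin le_t @l sz_l Ul lr sz @B la Br wl wBr tB {EFpr} => [|t] Ht tmin le_t l sz_l Ul lr sz B la Br wl wBr tB.
    case: (set_0Vmem (bundle B p)) => [|[g gB]]; first by left.
    right; exists g => //; suff : wt (bundle B p :\ g) <= wt (bundle B r) by rewrite -!(U_wt r).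
    apply: le_trans (wtS (subsetDl _ _)) _; rewrite /top take0 big_nil in wBr.
    have key (x y z t e : rat) : x <= y -> x + y = e -> z + t = e -> t = y - 0 -> z <= t.
      by move=> *; lra.
    exact: key le_pr tA tB wBr.
  right; have g0 : 'I_m by case: (s) le_t.
  exists (nth g0 s t).
    rewrite inE ffunE ifT //.
    by rewrite /l (take_nth g0) // mem_rcons inE eqxx.
  have gB : nth g0 s t \in bundle B p.
    by rewrite inE ffunE ifT // /l (take_nth g0) // mem_rcons inE eqxx.
  suff : wt (bundle B p :\ nth g0 s t) <= wt (bundle B r) by rewrite -!(U_wt r).
  have := wtD1 gB; have := topS u g0 le_t.
  (* Failure one step earlier reads [u(p) + s_t < u(r) - s_(t+1)]: the poor bundle without its
     latest good is worth less than what [r] keeps. *)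
  have : ~~ enough p r A t by apply/negP => /tmin; rewrite ltnn.
  rewrite /enough -ltNge; lra.
move=> i j ne_ij.
have two k : k = p \/ k = r.
  by case: (eqVneq k p) => [->|ne]; [left|right; apply/eqP; rewrite (agentE ne_pr)].
by case: (two i) ne_ij => ->; case: (two j) => ->; rewrite ?eqxx.
Qed.

End Greedy.

(** The least solution of [enough] is the optimum: greedy transfers attain it and no shorter
    sequence can. Monotonicity of [top] carries the inequality from the optimum to every larger
    [k]. *)
Theorem optimal_transfers_enough (p r : 'I_2) (A : allocation I) k : p != r ->
  wt (bundle A p) <= wt (bundle A r) ->
  (exists2 T, optimal_transfer_count A T & (T <= k)%N) <-> enough p r A k.
Proof.
move=> ne_pr le_pr; split=> [[T [HT _] le_T]|Hk].
  have := enough_of_EF1_after ne_pr HT; rewrite /enough.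
  have := top_mono u_ge0 (sorted_bundle r A) le_T.
  have : top u (sorted_bundle r A) T.+1 <= top u (sorted_bundle r A) k.+1.
    by apply: top_mono => //; apply: u_ge0.
  lra.
have ex : exists k, enough p r A k by exists k.
case: (ex_minnP ex) => t Ht tmin; exists t; last exact: tmin.
split; first exact: (EF1_after_enough ne_pr).
by move=> T' /(enough_of_EF1_after ne_pr)/tmin.
Qed.

End TwoAgents.

Local Close Scope ring_scope.

(** * Correctness of the decision procedure *)

(** The leading digit is 1; the default [true] lets the empty expansion of 0 pass the same test. *)
Lemma head_rev_binary n : head true (rev (binary n)).
Proof.
elim/ltn_ind: n => n IH; rewrite binaryE; case: eqP => // /eqP n0.
rewrite rev_cons; case: (posnP n./2) => [h0|h_gt0].
  by have -> : n = 1 by move: (odd_double_half n) n0; rewrite h0; case: (odd n) => /=; lia.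
have : size (rev (binary n./2)) != 0.
  by rewrite size_rev binaryE; case: (n./2) h_gt0.
case: (rev (binary n./2)) (IH n./2) => //= b u H _; apply: H.
by move: (odd_double_half n) n0; lia.
Qed.

Lemma binary_of_bits u : head true u -> binary (of_bits u 0) = rev u.
Proof.
elim/last_ind: u => // u b IH Hb.
rewrite /of_bits foldl_rcons -/(of_bits u 0) binary_cons_bit rev_rcons.
case: u IH Hb => [|a u] IH Hb; first by rewrite /= in Hb *; rewrite Hb.
have {}IH := IH Hb; rewrite IH ifT //; apply/orP; right; apply/eqP => E.
by move: IH; rewrite E => /(congr1 size); rewrite size_rev.
Qed.

Lemma decode_bits u ok cur out :
  foldl decode_step (ok, (cur, out)) [seq symbol_bits a | a <- [seq Some b | b <- u]] =
  (ok, (catrev u cur, out)).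
Proof. by elim: u cur => //= b u IH cur; rewrite IH. Qed.

Lemma decode_encode l out :
  foldl decode_step (true, ([::], out)) [seq symbol_bits a | a <- encode_nats l] =
  (true, ([::], catrev l out)).
Proof.
elim: l out => // n l IH out.
rewrite /encode_nats /= -/(encode_nats l) map_cat foldl_cat map_rcons foldl_rcons decode_bits.
by rewrite /decode_step /= -/(rev _) head_rev_binary of_bits_rev_binary IH.
Qed.

(** Invariant on prefixes: as long as the flag is set, the word is recovered from the finished
    numbers followed by the pending digits. Hence only genuine encodings are accepted. *)
Lemma decode_sound w : let s := decode_fold [seq symbol_bits a | a <- w] in
  s.1 -> w = encode_nats (rev s.2.2) ++ [seq Some b | b <- rev s.2.1].
Proof.
elim/last_ind: w => // w a; rewrite /decode_fold map_rcons foldl_rcons -/(decode_fold _).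
case: (decode_fold _) => ok [cur out] /= IH; case: a => [b|] /=.
  by move=> /IH{1}->; rewrite rev_cons map_rcons rcons_cat.
case/andP=> /IH{1}-> Hc; rewrite cats0 rev_cons /encode_nats map_rcons flatten_rcons.
by rewrite binary_of_bits // rcons_cat.
Qed.

Lemma decide_wordP w : decide_word [seq symbol_bits a | a <- w] <->
  exists2 l, w = encode_nats l & decide_nats l.
Proof.
split=> [/andP[/andP[ok /nilP cur] H]|[l -> H]]; last first.
  by rewrite /decide_word /decode_fold decode_encode /= -/(rev l) revK.
exists (rev (decode_fold [seq symbol_bits a | a <- w]).2.2) => //.
by have := decode_sound ok; rewrite cur cats0.
Qed.

(** * Splitting the list of numbers into instance data *)

Definition flat (u : seq frac) : seq nat := flatten [seq [:: q.1; q.2] | q <- u].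

Lemma size_flat u : size (flat u) = 2 * size u.
Proof. by elim: u => //= q u IH; rewrite IH mulnS. Qed.

Lemma flat_cons q u : flat (q :: u) = q.1 :: q.2 :: flat u.
Proof. by []. Qed.

Lemma pair_up_flat u : pair_up (flat u) = u.
Proof.
rewrite /pair_up; suff E out : foldl pair_step ([::], out) (flat u) = ([::], catrev u out).
  by rewrite E -/(rev u) revK.
by elim: u out => // -[a b] u IH out; rewrite flat_cons /= IH.
Qed.

Lemma flatP l m : size l = 2 * m -> exists2 u, size u = m & l = flat u.
Proof.
elim: m l => [|m IH] [|a [|b l]]; rewrite ?mulnS //; first by exists [::].
move=> /= -[/IH[u Eu ->]]; exists ((a, b) :: u) => //=.
by rewrite Eu.
Qed.

Lemma decide_natsP l : decide_nats l <-> exists m u0 u1 own k,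
  [/\ 0 < m, [/\ size u0 = m, size u1 = m & size own = m], decide_data u0 u1 own k
    & l = [:: 2; m] ++ (flat u0 ++ flat u1) ++ own ++ [:: k]].
Proof.
split=> [|[m [u0 [u1 [own [k [m0 [s0 s1 so] H ->]]]]]]].
  rewrite /decide_nats /decide_rest; case: l => [|a [|m r]] //=; first by rewrite andbF.
  case/andP=> /eqP-> /and3P[m0 /eqP sz].
  have [|u0 su0 E0] := @flatP (take (2 * m) r) m; first by rewrite size_takel; lia.
  have [|u1 su1 E1] := @flatP (take (2 * m) (drop (2 * m) r)) m.
    by rewrite size_takel // size_drop; lia.
  rewrite E0 E1 !pair_up_flat => H.
  exists m, u0, u1, (take m (drop (4 * m) r)), (head 0 (drop (5 * m) r)).
  split=> //; first by rewrite lt0n.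
    by split=> //; rewrite size_takel // size_drop; lia.
  rewrite -E0 -E1 /= -!catA; congr [:: _, _ & _].
  have -> : [:: head 0 (drop (5 * m) r)] = drop (5 * m) r.
    have : size (drop (5 * m) r) = 1 by rewrite size_drop; lia.
    by case: (drop _ _) => [|x []].
  have -> : 5 * m = m + 4 * m by lia.
  rewrite -drop_drop cat_take_drop.
  have -> : 4 * m = 2 * m + 2 * m by lia.
  by rewrite -drop_drop !cat_take_drop.
rewrite /decide_nats /decide_rest /= -!lt0n m0 /= !size_cat !size_flat s0 s1 so /=.
have t0 x : take (2 * m) (flat u0 ++ x) = flat u0.
  by apply: take_size_cat; rewrite size_flat s0.
have d0 x : drop (2 * m) (flat u0 ++ x) = x.
  by apply: drop_size_cat; rewrite size_flat s0.
have t1 x : take (2 * m) (flat u1 ++ x) = flat u1.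
  by apply: take_size_cat; rewrite size_flat s1.
have d1 x : drop (2 * m) (flat u1 ++ x) = x.
  by apply: drop_size_cat; rewrite size_flat s1.
have d4 x : drop (4 * m) (flat u0 ++ flat u1 ++ x) = x.
  have -> : 4 * m = 2 * m + 2 * m by lia.
  by rewrite -drop_drop d0 d1.
have d5 : drop (5 * m) (flat u0 ++ flat u1 ++ own ++ [:: k]) = [:: k].
  have -> : 5 * m = m + 4 * m by lia.
  by rewrite -drop_drop d4 drop_size_cat.
rewrite -!catA t0 d0 t1 d4 d5 !pair_up_flat take_size_cat //= H andbT.
by apply/eqP; lia.
Qed.

Local Open Scope ring_scope.

(** * Exact arithmetic and sorting of fractions, interpreted in the rationals *)

Definition qv (p : frac) : rat := p.1%:R / p.2%:R.

Definition pos_den : pred frac := fun q => (0 < q.2)%N.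

Lemma qv_addq p q : pos_den p -> pos_den q -> qv (addq p q) = qv p + qv q.
Proof.
case: p q => a b [x y]; rewrite /pos_den /qv /addq /= => Hb Hy.
by rewrite addf_div ?pnatr_eq0 -?lt0n // natrD !natrM.
Qed.

Lemma leqq_qv p q : pos_den p -> pos_den q -> leqq p q = (qv p <= qv q).
Proof.
case: p q => a b [x y]; rewrite /pos_den /qv /leqq /= => Hb Hy.
by rewrite ler_pdivrMr ?ltr0n // mulrAC ler_pdivlMr ?ltr0n // -!natrM ler_nat.
Qed.

Lemma sumq_qv l : all pos_den l -> pos_den (sumq l) /\ qv (sumq l) = \sum_(q <- l) qv q.
Proof.
elim/last_ind: l => [|l q IH]; first by rewrite big_nil /qv mul0r.
rewrite all_rcons => /andP[Hq /IH[Hs Es]].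
rewrite /sumq foldl_rcons -/(sumq l) qv_addq // Es -cats1 big_cat big_seq1.
by split=> //; rewrite /pos_den muln_gt0 [X in X && _]Hs.
Qed.

Definition ge_qv (p q : frac) := qv q <= qv p.

Lemma sortq_perm l : perm_eq (sortq l) l.
Proof.
elim/last_ind: l => // l p IH; rewrite /sortq foldl_rcons -/(sortq l) /insertq.
rewrite -cat1s perm_catCA perm_sym -cats1 perm_catC perm_cat2l perm_sym.
apply: perm_trans IH; rewrite perm_filterC; exact: perm_refl.
Qed.

(** [pairwise] passes directly to the two filtered halves of an insertion; entries from different
    halves are compared through the inserted fraction. *)
Lemma sortq_sorted l : all pos_den l -> pairwise ge_qv (sortq l).
Proof.
elim/last_ind: l => // l p IH; rewrite all_rcons => /andP[Hp Hl].
have Hs : all pos_den (sortq l) by rewrite (perm_all _ (sortq_perm l)).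
rewrite /sortq foldl_rcons -/(sortq l) /insertq pairwise_cat /= !pairwise_filter ?IH // andbT.
have hi q : q \in [seq q <- sortq l | leqq p q] -> qv p <= qv q.
  by rewrite mem_filter => /andP[H /(allP Hs) Hq]; rewrite -leqq_qv.
have lo q : q \in [seq q <- sortq l | ~~ leqq p q] -> qv q <= qv p.
  rewrite mem_filter => /andP[H /(allP Hs) Hq]; apply: ltW.
  by rewrite ltNge -leqq_qv.
apply/andP; split; last by apply/allP.
apply/allrelP => q q' Hq; rewrite inE => /orP[/eqP->|Hq']; first exact: hi.
by apply: le_trans (lo _ Hq') (hi _ Hq).
Qed.

Section Decision.
Variables (m : nat) (U : 'I_2 -> {set 'I_m} -> rat).
Variables (h2 : (1 < 2)%N) (h1 : (0 < m)%N) (Uge0 : forall i S, 0 <= U i S).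
Hypothesis Uadd : forall i S, U i S = \sum_(g in S) U i [set g].
Let I : instance rat := @Instance _ 2 m U h2 h1 Uge0 Uadd.
Hypothesis Hid : identical_utilities I.
Variables (A : allocation I) (num den : 'I_2 -> 'I_m -> nat).
Hypothesis den_gt0 : forall i g, (0 < den i g)%N.
Hypothesis U_frac : forall i g, U i [set g] = (num i g)%:R / (den i g)%:R.

Definition fracs (i : 'I_2) : seq frac := [seq (num i g, den i g) | g <- enum 'I_m].
Definition owners : seq nat := [seq val (A g) | g <- enum 'I_m].
Definition bundle_fracs (i : 'I_2) : seq frac :=
  [seq (num ord0 g, den ord0 g) | g <- enum (bundle A i)].

Lemma owned_fracs (i : 'I_2) : owned i (fracs ord0) owners = bundle_fracs i.
Proof.
rewrite /owned /fracs /owners zip_map filter_map -map_comp /bundle_fracs /enum_mem.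
rewrite -filter_predI; congr map; apply: eq_filter => g /=.
by rewrite !inE andbT.
Qed.

Lemma bundle_fracs_pos i : all pos_den (bundle_fracs i).
Proof. by apply/allP => _ /mapP[g _ ->]; apply: den_gt0. Qed.

Lemma sum_bundle_fracs i : \sum_(q <- bundle_fracs i) qv q = wt U (bundle A i).
Proof. by rewrite big_map big_enum; apply: eq_bigr => g _; rewrite /qv -U_frac. Qed.

(** The two sorting procedures may order ties differently, so the sorted goods cannot be matched.
    The lists of values agree, however: both are decreasing and they are permutations of each
    other. *)
Lemma top_sortq r k : \sum_(q <- take k (sortq (bundle_fracs r))) qv q =
  top (fun g => U ord0 [set g]) (sorted_bundle r A) k.
Proof.
rewrite /top -(big_map qv xpredT idfun) -(big_map (fun g => U ord0 [set g]) xpredT idfun).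
rewrite !map_take; congr (\sum_(x <- take k _) x).
apply: (@sorted_eq _ (fun x y : rat => y <= x)).
- by move=> x y z /= H1 H2; apply: le_trans H1.
- by move=> x y /andP[H1 H2]; apply/le_anti/andP.
- rewrite sorted_map sorted_pairwise; last by move=> p q r' H1 H2; apply: le_trans H1.
  exact: sortq_sorted (bundle_fracs_pos r).
- rewrite sorted_map; exact: sorted_s.
apply: perm_trans (perm_map _ (sortq_perm _)) _.
have -> : [seq qv i | i <- bundle_fracs r] = [seq U ord0 [set g] | g <- enum (bundle A r)].
  by rewrite -map_comp; apply: eq_map => g /=; rewrite U_frac.
by apply: perm_map; rewrite perm_sym perm_sort.
Qed.

Lemma few_transfers_enough (p r : 'I_2) k :
  few_transfers (bundle_fracs p) (bundle_fracs r) k = enough p r A k.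
Proof.
have Hs : all pos_den (sortq (bundle_fracs r)).
  by rewrite (perm_all _ (sortq_perm _)) bundle_fracs_pos.
have Ht j : all pos_den (take j (sortq (bundle_fracs r))).
  by apply/allP => q /mem_take; apply: (allP Hs).
have Hall : all pos_den (bundle_fracs p ++ take k (sortq (bundle_fracs r)) ++
    take (k + 1) (sortq (bundle_fracs r))).
  by rewrite !all_cat bundle_fracs_pos !Ht.
have [P1 E1] := sumq_qv (bundle_fracs_pos r); have [P2 E2] := sumq_qv Hall.
rewrite /few_transfers leqq_qv // E1 E2 !big_cat /= !sum_bundle_fracs !top_sortq.
by rewrite addn1 addrA.
Qed.

Lemma decide_bundlesP k :
  decide_bundles (owned 0 (fracs ord0) owners) (owned 1 (fracs ord0) owners) k <->
  exists2 T, optimal_transfer_count A T & (T <= k)%N.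
Proof.
rewrite (owned_fracs ord0) (owned_fracs (Ordinal (isT : (1 < 2)%N))) /decide_bundles.
set i1 := Ordinal _.
have [P0 E0] := sumq_qv (bundle_fracs_pos ord0).
have [P1 E1] := sumq_qv (bundle_fracs_pos i1).
rewrite leqq_qv // E0 E1 !sum_bundle_fracs.
case: ifPn => [le01|]; last rewrite -ltNge => /ltW le10.
  by rewrite few_transfers_enough -(optimal_transfers_enough Hid).
by rewrite few_transfers_enough -(optimal_transfers_enough Hid).
Qed.

Lemma valid_fracs : valid_data (fracs ord0) (fracs (Ordinal (isT : (1 < 2)%N))) owners.
Proof.
apply/and4P; split; try by apply/allP => _ /mapP[g _ ->] /=; rewrite -lt0n.
  by apply/allP => _ /mapP[g _ ->] /=; rewrite addn1; exact: ltn_ord (A g).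
apply/allP => z; rewrite zip_map => /mapP[g _ ->] /=.
have := Hid ord0 (Ordinal (isT : (1 < 2)%N)) [set g]; rewrite /= !U_frac.
move/eqP; rewrite eqr_div ?pnatr_eq0 -?lt0n //.
by rewrite -!natrM eqr_nat.
Qed.

End Decision.

Lemma enum_I2 : enum 'I_2 = [:: ord0; Ordinal (isT : (1 < 2)%N)].
Proof. by apply: (inj_map val_inj); rewrite val_enum_ord. Qed.

Lemma flatten_fracs m (num den : 'I_2 -> 'I_m -> nat) :
  flatten [seq [:: num i g; den i g] | i <- enum 'I_2, g <- enum 'I_m] =
  flat (fracs num den ord0) ++ flat (fracs num den (Ordinal (isT : (1 < 2)%N))).
Proof. by rewrite enum_I2 /= cats0 flatten_cat /flat /fracs -!map_comp. Qed.

Lemma decide_encodes (I : instance rat) (A : allocation I) k w :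
  agents I = 2%N -> identical_utilities I -> encodes w A k ->
  (exists2 T, optimal_transfer_count A T & (T <= k)%N) ->
  exists2 l, w = encode_nats l & decide_nats l.
Proof.
(* The number of agents must be replaced by 2 inside all dependent fields before the results on
   ['I_2] apply. *)
case: I A => n m U n2 m1 Uge0 Uadd A /= En; move: U n2 Uge0 Uadd A; rewrite {n}En.
move=> U n2 Uge0 Uadd A Hid [num [den [/= Hden Hval ->]]] HT.
eexists; first reflexivity.
apply/decide_natsP.
exists m, (fracs num den ord0), (fracs num den (Ordinal (isT : (1 < 2)%N))), (owners A), k.
split=> //; first by split; rewrite size_map -cardE card_ord.
  apply/andP; split; first exact: (valid_fracs Hid).
  exact/(decide_bundlesP Hid A Hden Hval).
by rewrite flatten_fracs.
Qed.

Lemma map_nth_enum m (T U : Type) (x0 : T) (u : seq T) (f : T -> U) : size u = m ->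
  [seq f (nth x0 u (val g)) | g <- enum 'I_m] = [seq f x | x <- u].
Proof.
move=> <-; rewrite (map_comp (fun j => f (nth x0 u j)) val) val_enum_ord.
by rewrite (map_comp f) [X in map f X](mkseq_nth x0 u).
Qed.

(** Every accepted list is realized by an explicit instance, of which it is then the encoding. *)
Lemma encodes_decide w l : w = encode_nats l -> decide_nats l ->
  OptimalTransfers (fun I : instance rat => agents I = 2%N /\ identical_utilities I) w.
Proof.
move=> Ew /decide_natsP[m [u0 [u1 [own [k [m1 [s0 s1 so] /andP[Hv Hd] El]]]]]].
pose num (i : 'I_2) (g : 'I_m) := (nth (0%N, 1%N) (if i == ord0 then u0 else u1) g).1.
pose den (i : 'I_2) (g : 'I_m) := (nth (0%N, 1%N) (if i == ord0 then u0 else u1) g).2.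
(* Both agents get the values listed for the first, which makes the utilities identical by
   definition; the cross-multiplication test shows that the second agent's fractions represent them
   too. *)
pose U (i : 'I_2) (S : {set 'I_m}) : rat :=
  \sum_(g in S) (num ord0 g)%:R / (den ord0 g)%:R.
have Uge0 i S : 0 <= U i S.
  by apply: sumr_ge0 => g _; rewrite divr_ge0 ?ler0n.
have Uadd i S : U i S = \sum_(g in S) U i [set g].
  by apply: eq_bigr => g _; rewrite /U big_set1.
pose I : instance rat := @Instance _ 2 m U isT m1 Uge0 Uadd.
have [/allP V0 /allP V1 /allP Vo /allP Vz] := and4P Hv.
(* The owner test keeps the entries below 2, so [inord] does not alter them. *)
pose A : allocation I := [ffun g => inord (nth 0%N own (val g))].
have Hid : identical_utilities I by [].
have Hden i g : (0 < den i g)%N.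
  rewrite lt0n /den; case: ifP => _; [apply: V0|apply: V1]; apply: mem_nth.
    by rewrite s0.
  by rewrite s1.
have Hval i g : U i [set g] = (num i g)%:R / (den i g)%:R.
  rewrite /U big_set1; case: (eqVneq i ord0) => [->//|i0].
  apply/eqP; rewrite eqr_div ?pnatr_eq0 -?lt0n // -!natrM eqr_nat.
  rewrite /num /den eqxx (negPf i0).
  apply: (Vz (nth (0%N, 1%N) u0 g, nth (0%N, 1%N) u1 g)).
  rewrite -nth_zip ?s0 ?s1 //; apply: mem_nth.
  by rewrite size_zip s0 s1 minnn.
have F0 : fracs num den ord0 = u0.
  rewrite /fracs -[RHS]map_id -(@map_nth_enum m _ _ (0%N, 1%N) u0 id) //.
  by apply: eq_map => g; rewrite /num /den eqxx -surjective_pairing.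
have F1 : fracs num den (Ordinal (isT : (1 < 2)%N)) = u1.
  rewrite /fracs -[RHS]map_id -(@map_nth_enum m _ _ (0%N, 1%N) u1 id) //.
  by apply: eq_map => g; rewrite /num /den /= -surjective_pairing.
have Fo : owners A = own.
  rewrite /owners -[RHS]map_id -(@map_nth_enum m _ _ 0%N own id) //.
  apply: eq_map => g; rewrite ffunE /= inordK //.
  by rewrite -addn1; apply: Vo; apply: mem_nth; rewrite so.
exists I, A, k; split=> //.
  exists num, den; split=> //.
  rewrite Ew El /= -[enum 'I_(goods I)]/(enum 'I_m) flatten_fracs F0 F1.
  by rewrite -[map _ _]/(owners A) Fo.
apply/(decide_bundlesP Hid A Hden Hval).
by rewrite F0 Fo.
Qed.

Local Close Scope ring_scope.

Theorem theoremC1 :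
  in_P (OptimalTransfers (fun I : instance rat =>
    agents I = 2 /\ identical_utilities I)).
Proof.
apply: in_P_polytime polytime_decide_word _ => w.
rewrite decide_wordP; split=> [[l Ew Hl]|[I [A [k [[I2 Hid] Hw HT]]]]].
  exact: encodes_decide Ew Hl.
exact: decide_encodes I2 Hid Hw HT.
Qed.
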